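(* There exists $\epsilon>0$ such that for any non-virtually solvable subgroup $G$ of $\mathrm{SA}(2,\mathbb{Z})$ which does not have a global fixed point, and any subgroup $H\leq G$ which is not Zariski dense in $G$, we have $\kappa_G(\lambda_{G/H})>\epsilon$.
   Context: $\mathrm{SA}(2,\mathbb{Z})=\mathrm{SL}(2,\mathbb{Z})\ltimes\mathbb{Z}^2$, acting on $\mathbb{R}^2$ by affine transformations $gx=\theta(g)x+\tau(g)$ and viewed as a subgroup of the real algebraic group $\mathrm{SA}(2,\mathbb{R})=\mathrm{SL}(2,\mathbb{R})\ltimes\mathbb{R}^2$. A global fixed point is a point of $\mathbb{R}^2$ fixed by every element of $G$. ''$H$ is not Zariski dense in $G$'' means that the Zariski closure of $H$ in $\mathrm{SA}(2,\mathbb{R})$ is strictly smaller than that of $G$. $\lambda_{G/H}$ is the quasi-regular representation of $G$ on $\ell^2(G/H)$, $[\lambda_{G/H}(g)f](x)=f(g^{-1}x)$. For a unitary representation $(\pi,\mathcal{H})$ of a countable group $G$ and a finite set $S\subset G$, $\kappa_G(S,\pi)=\inf\{\sup_{g\in S}\|\pi(g)\xi-\xi\| : \xi\in\mathcal{H},\ \|\xi\|=1\}$, and $\kappa_G(\pi)=\inf_S\kappa_G(S,\pi)$, the infimum being over all finite sets $S$ generating $G$. *)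

(* Defs.v *)
From HB Require Import structures.
From mathcomp Require Import all_boot all_order all_algebra finmap.
From mathcomp Require Import boolp classical_sets functions cardinality fsbigop.
From mathcomp Require Import reals ereal esum complex.
From mathcomp Require Import ring.
From mathcomp Require mpoly.

Set Implicit Arguments.
Unset Strict Implicit.
Unset Printing Implicit Defensive.

Import Order.TTheory GRing.Theory Num.Theory.

Local Open Scope classical_set_scope.
Local Open Scope ring_scope.
Local Open Scope complex_scope.

Record subgroup (gT : groupType) := Subgroup {
  carrier :> set gT;
  subgroup1 : carrier 1%g;
  subgroupM : forall x y, carrier x -> carrier y -> carrier (x * y)%g;
  subgroupV : forall x, carrier x -> carrier (x^-1)%g
}.

(* A subgroup as a group in its own right, so that a subgroup of [G] is a
   term of type [subgroup (elt G)]. *)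
Definition elt (gT : groupType) (G : subgroup gT) : Type :=
  {x : gT | x \in carrier G}.

Section Elt.
Variables (gT : groupType) (G : subgroup gT).

HB.instance Definition _ := SubChoice.on (elt G).

Fact elt_group_closed : group_closed (mem (carrier G)).
Proof.
split=> [|x y]; rewrite !inE; first exact: subgroup1.
by move=> Gx Gy; apply: subgroupM => //; exact: subgroupV.
Qed.

HB.instance Definition _ :=
  SubChoice_isSubGroup.Build gT (mem (carrier G)) (elt G) elt_group_closed.
End Elt.

Section GroupTheory.
Variable gT : groupType.
Implicit Types (A : set gT) (H : subgroup gT).

Definition generated A : set gT :=
  [set x | forall K : subgroup gT, A `<=` carrier K -> carrier K x].

Definition derived A : set gT :=
  generated [set z | exists x y, [/\ A x, A y & z = [~ x, y]%g]].

Definition solvable H : Prop := exists n, iter n derived H = [set 1%g].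

Definition left_coset (x : gT) A : set gT := [set (x * a)%g | a in A].

Definition left_cosets H : set (set gT) := [set left_coset x H | x in setT].

Definition quot H : Type := {C : set gT | C \in left_cosets H}.
HB.instance Definition _ H := SubChoice.on (quot H).

Lemma left_cosetM x y A :
  left_coset x (left_coset y A) = left_coset (x * y)%g A.
Proof.
rewrite /left_coset image_comp; apply: eq_imagel => a _ /=.
by rewrite mulgA.
Qed.

Lemma left_coset1 A : left_coset 1%g A = A.
Proof.
rewrite /left_coset -[RHS]image_id; apply: eq_imagel => a _.
by rewrite mul1g.
Qed.

Lemma quot_act_proof H x (C : quot H) :
  left_coset x (val C) \in left_cosets H.
Proof.
have := valP C; rewrite !inE => -[y _ <-].
by exists (x * y)%g => //; rewrite left_cosetM.
Qed.

Definition quot_act H (x : gT) (C : quot H) : quot H :=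
  Sub (left_coset x (val C)) (quot_act_proof x C).

Lemma quot_actM H x y (C : quot H) :
  quot_act x (quot_act y C) = quot_act (x * y)%g C.
Proof. by apply/val_inj => /=; rewrite left_cosetM. Qed.

Lemma quot_act1 H (C : quot H) : quot_act 1%g C = C.
Proof. by apply/val_inj => /=; rewrite left_coset1. Qed.

Definition virtually_solvable : Prop :=
  exists2 K : subgroup gT, finite_set (left_cosets K) & solvable K.

End GroupTheory.

Section L2.
Variables (R : realType) (X : choiceType).
Implicit Types (f g : X -> R[i]).

Local Notation normc := ComplexField.Normc.normc.

Definition sum_sqr f : \bar R :=
  (\esum_(x in [set: X]) (normc (f x) ^+ 2)%:E)%E.

Definition square_summable : {pred X -> R[i]} :=
  [pred f | (sum_sqr f < +oo)%E].

Lemma normc_ge0 (z : R[i]) : 0 <= normc z.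
Proof. by case: z => a b /=; exact: sqrtr_ge0. Qed.

Lemma sum_sqr_ge0 f : (0 <= sum_sqr f)%E.
Proof. by apply: esum_ge0 => x _; rewrite lee_fin sqr_ge0. Qed.

Lemma esum_scale (c : R) (a : X -> R) : 0 <= c -> (forall x, 0 <= a x) ->
  (\esum_(x in [set: X]) (c * a x)%:E = c%:E * \esum_(x in [set: X]) (a x)%:E)%E.
Proof.
move=> c0 a0; rewrite /esum -ereal_supZl //; last first.
  by apply/set0P; exists (\sum_(x \in set0) (a x)%:E)%E; exists set0 => //; exact: fsets_set0.
congr ereal_sup; rewrite image_comp; apply: eq_imagel => A [finA _] /=.
rewrite ge0_mule_fsumr; last by move=> x; rewrite lee_fin.
by apply: eq_fsbigr => x _; rewrite EFinM.
Qed.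

Lemma sum_sqrZ (c : R[i]) f :
  sum_sqr (fun x => c * f x) = ((normc c ^+ 2)%:E * sum_sqr f)%E.
Proof.
rewrite /sum_sqr -esum_scale ?sqr_ge0//; last by move=> x; rewrite sqr_ge0.
by apply: eq_esum => x _; rewrite ComplexField.Normc.normcM exprMn.
Qed.

Lemma sum_sqrD (t : R) f g : 0 < t ->
  (sum_sqr (fun x => f x + g x)%R <=
    (1 + t)%:E * sum_sqr f + (1 + t^-1)%:E * sum_sqr g)%E.
Proof.
move=> t0; have ti0 : 0 < t^-1 by rewrite invr_gt0.
have t1 : 0 <= 1 + t by rewrite addr_ge0 ?ltW.
have ti1 : 0 <= 1 + t^-1 by rewrite addr_ge0 ?ltW.
rewrite /sum_sqr -!esum_scale//; try by move=> x; rewrite sqr_ge0.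
rewrite -esumD; try by move=> x _; rewrite lee_fin mulr_ge0 ?sqr_ge0.
apply: le_esum => x _; rewrite -EFinD lee_fin.
set a := normc (f x); set b := normc (g x).
have a0 : 0 <= a := normc_ge0 _; have b0 : 0 <= b := normc_ge0 _.
apply: (@le_trans _ _ ((a + b) ^+ 2)).
  by rewrite ler_sqr ?nnegrE ?addr_ge0 ?normc_ge0//; exact: le_normcD.
rewrite -subr_ge0.
suff -> : (1 + t) * a ^+ 2 + (1 + t^-1) * b ^+ 2 - (a + b) ^+ 2
    = t^-1 * (t * a - b) ^+ 2 by rewrite mulr_ge0 ?sqr_ge0 ?ltW.
by field; rewrite gt_eqF.
Qed.

Fact square_summable_closed : GRing.submod_closed square_summable.
Proof.
split.
  rewrite inE /= [sum_sqr _](_ : _ = 0%E) ?ltry//.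
  by apply: esum1 => x _; rewrite ComplexField.Normc.normc0 expr0n.
move=> c f g; rewrite !inE => ff gf.
apply: le_lt_trans (sum_sqrD (fun x => c * f x) g ltr01) _.
rewrite sum_sqrZ.
have fin u : (sum_sqr u < +oo)%E -> sum_sqr u \is a fin_num.
  by move=> ?; rewrite ge0_fin_numE// sum_sqr_ge0.
rewrite -(fineK (fin _ ff)) -(fineK (fin _ gf)).
by rewrite -!EFinM -EFinD ltry.
Qed.

Record l2 : Type := L2 { l2_val :> X -> R[i]; _ : l2_val \in square_summable }.

HB.instance Definition _ := [isSub for l2_val].
HB.instance Definition _ := [Choice of l2 by <:].
HB.instance Definition _ := GRing.SubChoice_isSubLmodule.Build
  R[i] (X -> R[i]) square_summable l2 square_summable_closed.

Definition l2_norm (f : l2) : R := Num.sqrt (fine (sum_sqr f)).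

Lemma l2_normE (f : l2) : sum_sqr f = (l2_norm f ^+ 2)%:E.
Proof.
rewrite sqr_sqrtr ?fine_ge0 ?sum_sqr_ge0// fineK// ge0_fin_numE ?sum_sqr_ge0//.
by case: f => f /= ff; move: ff; rewrite inE.
Qed.

Lemma l2_norm_ge0 (f : l2) : 0 <= l2_norm f.
Proof. exact: sqrtr_ge0. Qed.

Lemma l2_norm_eq0 (f : l2) : l2_norm f = 0 -> f = 0.
Proof.
move=> f0; apply/val_inj/funext => x /=.
have := l2_normE f; rewrite f0 expr0n /= => s0.
have : ((normc (f x) ^+ 2)%:E <= sum_sqr f)%E.
  rewrite -(@esum_set1 _ _ x (fun x => (normc (f x) ^+ 2)%:E)) ?lee_fin ?sqr_ge0//.
  rewrite /sum_sqr [leRHS](esumID [set x])//; last by move=> ? _; rewrite lee_fin sqr_ge0.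
  by rewrite setTI leeDl// esum_ge0// => ? _; rewrite lee_fin sqr_ge0.
rewrite s0 lee_fin => n0; apply: ComplexField.Normc.eq0_normc.
by apply/eqP; rewrite -sqrf_eq0 eq_le n0 sqr_ge0.
Qed.

Lemma l2_normZ (c : R[i]) (f : l2) : l2_norm (c *: f) = normc c * l2_norm f.
Proof.
apply/eqP; rewrite -(@eqrXn2 _ 2) ?mulr_ge0 ?l2_norm_ge0 ?normc_ge0//.
by rewrite -eqe -l2_normE exprMn EFinM -l2_normE -sum_sqrZ.
Qed.

Lemma l2_norm0 : l2_norm 0 = 0.
Proof.
by rewrite -(scale0r (0 : l2)) l2_normZ ComplexField.Normc.normc0 mul0r.
Qed.

Lemma l2_normD (f g : l2) : l2_norm (f + g) <= l2_norm f + l2_norm g.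
Proof.
have [/l2_norm_eq0 ->|f0] := eqVneq (l2_norm f) 0.
  by rewrite add0r l2_norm0 add0r.
have [/l2_norm_eq0 ->|g0] := eqVneq (l2_norm g) 0.
  by rewrite addr0 l2_norm0 addr0.
set a := l2_norm f in f0 *; set b := l2_norm g in g0 *.
have a0 : 0 < a by rewrite lt_def f0 l2_norm_ge0.
have b0 : 0 < b by rewrite lt_def g0 l2_norm_ge0.
rewrite -ler_sqr ?nnegrE ?l2_norm_ge0 ?addr_ge0 ?(ltW a0) ?(ltW b0)//.
have := sum_sqrD f g (divr_gt0 b0 a0).
rewrite !l2_normE (_ : sum_sqr _ = (l2_norm (f + g) ^+ 2)%:E) -?l2_normE//.
rewrite !l2_normE -!EFinM -EFinD lee_fin -/a -/b => /le_trans; apply.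
suff -> : (1 + b / a) * a ^+ 2 + (1 + (b / a)^-1) * b ^+ 2 = (a + b) ^+ 2 by [].
by field; rewrite f0 g0.
Qed.

Lemma l2_normMn (f : l2) n : l2_norm (f *+ n) = l2_norm f *+ n.
Proof.
by rewrite -scaler_nat l2_normZ normcMn ComplexField.Normc.normc1 mulr_natl.
Qed.

Lemma l2_normN (f : l2) : l2_norm (- f) = l2_norm f.
Proof.
by rewrite -scaleN1r l2_normZ normcN ComplexField.Normc.normc1 mul1r.
Qed.

HB.instance Definition _ := Num.Zmodule_isNormed.Build
  R l2 l2_normD l2_norm_eq0 l2_normMn l2_normN.

End L2.

Section QuasiRegular.
Variables (R : realType) (gT : groupType) (H : subgroup gT).

Lemma sum_sqr_translate (g : gT) (f : quot H -> R[i]) :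
  sum_sqr (fun C => f (quot_act g^-1%g C)) = sum_sqr f.
Proof.
rewrite /sum_sqr [RHS](reindex_esum setT setT (quot_act g^-1%g)) //.
split=> //.
- move=> C D _ _ /(congr1 (quot_act g)).
  by rewrite !quot_actM mulgV !quot_act1.
- by move=> C _; exists (quot_act g C) => //; rewrite quot_actM mulVg quot_act1.
Qed.

Fact lambda_proof (g : gT) (f : l2 R (quot H)) :
  (fun C => f (quot_act g^-1%g C)) \in @square_summable R (quot H).
Proof. by rewrite inE /= sum_sqr_translate l2_normE ltry. Qed.

Definition lambda (g : gT) (f : l2 R (quot H)) : l2 R (quot H) :=
  L2 (lambda_proof g f).

Lemma lambda_linear g : linear (lambda g).
Proof. by move=> c f1 f2; apply/val_inj. Qed.

Lemma lambdaM g1 g2 f : lambda (g1 * g2)%g f = lambda g1 (lambda g2 f).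
Proof.
by apply/val_inj/funext => C /=; rewrite quot_actM invgM.
Qed.

Lemma lambda1 f : lambda 1%g f = f.
Proof. by apply/val_inj/funext => C /=; rewrite invg1 quot_act1. Qed.

Lemma norm_lambda g f : `|lambda g f| = `|f|.
Proof. by congr (Num.sqrt (fine _)); exact: sum_sqr_translate. Qed.

End QuasiRegular.

Arguments lambda R {gT} H g f.

(* For a unitary representation on a Hilbert space V, kappa involves only the
   norm of V and the action pi, so nothing more is required here. *)
Section Kazhdan.
Variables (R : realType) (gT : groupType) (V : normedZmodType R).
Variable pi : gT -> V -> V.

(* The supremum over [S] starts from 0, which matters only for empty [S]. *)
Definition kappa_on (S : {fset gT}) : \bar R :=
  ereal_inf [set (\big[Num.max/0]_(g <- S) `|pi g xi - xi|)%:E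
            | xi in [set xi : V | `|xi| = 1]].

(* As an infimum in the extended reals, this is +oo when the group is not
   finitely generated. *)
Definition kappa : \bar R :=
  ereal_inf [set kappa_on S
            | S in [set S : {fset gT} | generated [set` S] = setT]].

End Kazhdan.

(* SA(2, A), the pair (theta, tau) being the affine map x |-> theta x + tau *)
Section SpecialAffine.
Variable A : comNzRingType.

Definition SA_pred : {pred 'M[A]_2 * 'cV[A]_2} := [pred p | \det p.1 == 1].

Record SA : Type := MkSA { SA_val :> 'M[A]_2 * 'cV[A]_2; _ : SA_val \in SA_pred }.

HB.instance Definition _ := [isSub for SA_val].
HB.instance Definition _ := [Choice of SA by <:].

Definition theta (g : SA) : 'M[A]_2 := g.1.
Definition tau (g : SA) : 'cV[A]_2 := g.2.

Definition affine (g : SA) (x : 'cV[A]_2) : 'cV[A]_2 := theta g *m x + tau g.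

Lemma det_theta g : \det (theta g) = 1.
Proof. by apply/eqP; have := valP g; rewrite inE. Qed.

Fact SA_one_proof : (1%:M, 0) \in SA_pred.
Proof. by rewrite inE /= det1. Qed.

Fact SA_mul_proof g h :
  (theta g *m theta h, theta g *m tau h + tau g) \in SA_pred.
Proof. by rewrite inE /= det_mulmx !det_theta mulr1. Qed.

Lemma adj_thetaK g : \adj (theta g) *m theta g = 1%:M.
Proof. by rewrite mul_adj_mx det_theta. Qed.

Lemma theta_adjK g : theta g *m \adj (theta g) = 1%:M.
Proof. by rewrite mul_mx_adj det_theta. Qed.

Fact SA_inv_proof g :
  (\adj (theta g), - (\adj (theta g) *m tau g)) \in SA_pred.
Proof.
rewrite inE /= -[X in X == _]mulr1 -(det_theta g) -det_mulmx adj_thetaK.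
by rewrite det1 det_theta.
Qed.

Definition SA_one : SA := MkSA SA_one_proof.
Definition SA_mul g h : SA := MkSA (SA_mul_proof g h).
Definition SA_inv g : SA := MkSA (SA_inv_proof g).

Lemma SA_eq (g h : SA) : theta g = theta h -> tau g = tau h -> g = h.
Proof.
by move=> ? ?; apply/val_inj; rewrite /= [LHS]surjective_pairing [RHS]surjective_pairing; congr pair.
Qed.

Fact SA_mulA : associative SA_mul.
Proof.
move=> g h k; apply: SA_eq; rewrite /theta /tau /= ?mulmxA//.
by rewrite mulmxDr mulmxA addrA.
Qed.

Fact SA_mul1 : left_id SA_one SA_mul.
Proof. by move=> g; apply: SA_eq; rewrite /theta /tau /= mul1mx ?addr0. Qed.

Fact SA_mulr1 : right_id SA_one SA_mul.
Proof.
by move=> g; apply: SA_eq; rewrite /theta /tau /= ?mulmx1// mulmx0 add0r.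
Qed.

Fact SA_mulV : left_inverse SA_one SA_inv SA_mul.
Proof.
move=> g; apply: SA_eq; first exact: adj_thetaK.
by rewrite /tau /= subrr.
Qed.

Fact SA_mulrV : right_inverse SA_one SA_inv SA_mul.
Proof.
move=> g; apply: SA_eq; first exact: theta_adjK.
by rewrite {1}/tau /= mulmxN mulmxA theta_adjK mul1mx addNr.
Qed.

HB.instance Definition _ :=
  isGroup.Build SA SA_mulA SA_mul1 SA_mulr1 SA_mulV SA_mulrV.

Lemma affineM (g h : SA) x : affine (g * h)%g x = affine g (affine h x).
Proof. by rewrite /affine mulmxDr mulmxA addrA. Qed.

End SpecialAffine.

Section RealPoints.
Variable R : realType.

Fact SA_real_proof (g : SA int) :
  (map_mx intr (theta g), map_mx intr (tau g)) \in @SA_pred R.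
Proof. by rewrite inE /= det_map_mx det_theta rmorph1. Qed.

Definition SA_real (g : SA int) : SA R := MkSA (SA_real_proof g).

Definition has_global_fixed_point (G : set (SA int)) : Prop :=
  exists x : 'cV[R]_2, forall g, G g -> affine (SA_real g) x = x.

Definition SA_coord (g : SA R) (i : 'I_6) : R :=
  nth 0 [:: theta g 0 0; theta g 0 1; theta g 1 0; theta g 1 1;
            tau g 0 0; tau g 1 0] i.

(* The common zeros in SA(2, R) of the real polynomials in the four entries
   of theta and the two entries of tau that vanish on A. *)
Definition zariski_closure (A : set (SA R)) : set (SA R) :=
  [set x | forall p : mpoly.mpoly 6 R,
     (forall a, A a -> mpoly.meval (SA_coord a) p = 0) ->
     mpoly.meval (SA_coord x) p = 0].

End RealPoints.

(* Main.v *)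
Require Import Defs.
From HB Require Import structures.
From mathcomp Require Import all_boot all_order all_algebra finmap.
From mathcomp Require Import boolp classical_sets functions cardinality.
From mathcomp Require Import reals ereal esum complex.
From mathcomp Require Import ring lra zify.
From mathcomp Require unstable mpoly.
Import (canonicals) mpoly.

Set Implicit Arguments.
Unset Strict Implicit.
Unset Printing Implicit Defensive.

Import Order.TTheory GRing.Theory Num.Theory.

Local Open Scope classical_set_scope.
Local Open Scope ring_scope.

(** Let [f] be a unit vector of l2(G / H) which no element of the generating set [S]
displaces by more than [d]. If a subset [W] of G / H is disjoint from its translates
by the positive powers of some [g], then [f], being nearly invariant under [g], has
nearly the same norm on each translate, and orthogonality bounds the norm of [f] on [W] by [1/3] plus a
multiple of [|g f - f|] ([wandering_cut]). Five such sets cannot cover G / H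
when the corresponding [g] are words of bounded length in [S] and [d] is small
([no_cover]). So one has to find words of bounded length and coverings with estimates
that depend neither on [G] nor on [S].

Words. The linear part of [G] normalizes no line of sl2(R), otherwise [G] would be
solvable ([solvable_of_line]). If [s] in [S] is not hyperbolic and [t] in [S] moves the line
of the traceless part of [s], then the trace [2 - det (s t - t s)] of their commutator is an
integer greater than [2]; so some word [a] of length at most [8] is hyperbolic
([hyperbolic_word]). As [G] fixes no point, some element of [S], or product
of two of them, moves both the axes of [a] and its fixed point in the plane; call it [g]
([short_hyperbolic_pair]).

Uniformity. Let [l] be the large eigenvalue of [a], and let [(al, be; ga, de)] be the
matrix of determinant one that compares the eigencoordinates of [a] with those
of [c = g a g^-1]. The numbers [al de (l - 1/l)^2] and [be ga (l - 1/l)^2] are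
integers, as they are traces of words up to sign and a shift by [2] ([eigen_change]), and they do not vanish since
the discriminant of [a] is not a square ([transverse]). Hence the cross ratio
[al de / (be ga)] lies between [l^-3] and [l^3]: on the scale of [a] itself, the fixed
points of [a] and of [c] at infinity are far apart.

Coverings. Suppose that [H] fixes a point of the plane, so that G / H maps to the plane.
The eigencoordinates [u], [v] centred at the fixed point of [a] are multiplied by [l] and
[1/l] under [a]; so a shell [r <= |u| <= l^k r] is disjoint from its
translates by a fixed power of [a], and so are the shells for [v], for [u/v], and the
shells for [c]. A point outside the shells of [a] is close to a fixed point of [a]
in the projective plane, hence far from those of [c], and lies in a shell of [c]
([plane_cover]). If [H] normalizes a line of sl2(R), the same is done in the
projective plane of sl2(R) ([sl2_cover]).

Dichotomy. If [H] neither fixes a point nor normalizes a line, it is Zariski dense in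
SA(2, R) ([zariski_dense]): its closure contains the torus of a hyperbolic element, whose
element [-1] is a point reflection; two point reflections give a translation,
hence all of them; and two transverse tori generate SL2(R) ([tori_generate]). *)

(** * Restricting square-summable functions to subsets *)

Section Cutoff.
Variables (R : realType) (X : choiceType).
Implicit Types (W : set X) (f g : l2 R X).

Local Notation normc := ComplexField.Normc.normc.

Lemma sum_sqr_cut W (f : X -> R[i]) :
  (sum_sqr (fun x => if x \in W then f x else 0%R) <= sum_sqr f)%E.
Proof.
apply: le_esum => x _; rewrite lee_fin; case: ifP => // _.
by rewrite ComplexField.Normc.normc0 expr0n sqr_ge0.
Qed.

Fact cut_proof W f :
  (fun x => if x \in W then f x else 0) \in @square_summable R X.
Proof.
by rewrite inE /=; apply: le_lt_trans (sum_sqr_cut W f) _; rewrite l2_normE ltry.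
Qed.

Definition cut W f : l2 R X := L2 (cut_proof W f).

Lemma cutB W f g : cut W (f - g) = cut W f - cut W g.
Proof.
apply/val_inj/funext => x /=; rewrite !fctE /=.
by case: ifP => // _; rewrite subrr.
Qed.

Lemma sqr_normE f : ((`|f| ^+ 2)%:E = sum_sqr f)%E.
Proof. by rewrite l2_normE. Qed.

Lemma norm_cut W f : `|cut W f| <= `|f|.
Proof.
by rewrite -ler_sqr ?nnegrE// -lee_fin !sqr_normE sum_sqr_cut.
Qed.

Lemma sqr_norm_cutE W f :
  ((`|cut W f| ^+ 2)%:E =
   \esum_(x in [set: X]) ((x \in W)%:R * normc (f x) ^+ 2)%:E)%E.
Proof.
rewrite sqr_normE; apply: eq_esum => x _ /=; case: ifP => _; first by rewrite mul1r.
by rewrite ComplexField.Normc.normc0 expr0n mul0r.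
Qed.

Lemma sum_sqr_norm_cut n (W : 'I_n -> set X) f :
  ((\sum_(i < n) `|cut (W i) f| ^+ 2)%:E =
   \esum_(x in [set: X]) ((\sum_(i < n) (x \in W i)%:R) * normc (f x) ^+ 2)%:E)%E.
Proof.
rewrite -sumEFin; under eq_bigr do rewrite sqr_norm_cutE.
rewrite -esum_sum; last by move=> x i _ _; rewrite lee_fin mulr_ge0// sqr_ge0.
by apply: eq_esum => x _; rewrite sumEFin mulr_suml.
Qed.

Lemma norm_le_cover n (W : 'I_n -> set X) f :
  (forall x, exists i, W i x) -> `|f| ^+ 2 <= \sum_(i < n) `|cut (W i) f| ^+ 2.
Proof.
move=> cov; rewrite -lee_fin sum_sqr_norm_cut sqr_normE; apply: le_esum => x _.
rewrite lee_fin ler_peMl ?sqr_ge0//; have [i Wi] := cov x.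
by rewrite (bigD1 i)//= mem_set// lerDl sumr_ge0.
Qed.

Lemma norm_ge_disjoint n (W : 'I_n -> set X) f :
  (forall i j x, W i x -> W j x -> i = j) ->
  \sum_(i < n) `|cut (W i) f| ^+ 2 <= `|f| ^+ 2.
Proof.
move=> dis; rewrite -lee_fin sum_sqr_norm_cut sqr_normE; apply: le_esum => x _.
rewrite lee_fin ler_piMl ?sqr_ge0//.
have [[i Wi]|no] := pselect (exists i, W i x).
  rewrite (bigD1 i)//= mem_set// big1 ?addr0// => j ji.
  by rewrite memNset// => Wj; move: ji; rewrite (dis _ _ _ Wi Wj) eqxx.
by rewrite big1// => i _; rewrite memNset// => Wi; apply: no; exists i.
Qed.

End Cutoff.

(** * Almost invariant vectors and wandering sets *)

Section Displacement.
Variables (R : realType) (gT : groupType) (H : subgroup gT).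
Implicit Types (g : gT) (f : l2 R (quot H)).

Definition displacement f g : R := `|lambda R H g f - f|.

Lemma lambdaB g (f1 f2 : l2 R (quot H)) :
  lambda R H g (f1 - f2) = lambda R H g f1 - lambda R H g f2.
Proof. by apply/val_inj. Qed.

Lemma displacementM f g h :
  displacement f (g * h)%g <= displacement f g + displacement f h.
Proof.
rewrite /displacement lambdaM [leRHS]addrC -(norm_lambda g (lambda R H h f - f)) lambdaB.
by apply: le_trans (ler_normD _ _); rewrite subrKA.
Qed.

Lemma displacementV f g : displacement f g^-1%g = displacement f g.
Proof.
by rewrite /displacement -(norm_lambda g) lambdaB -lambdaM mulgV lambda1 distrC.
Qed.

Lemma displacementX f g n : displacement f (g ^+ n)%g <= n%:R * displacement f g.
Proof.
elim: n => [|n IHn]; first by rewrite expg0 mul0r /displacement lambda1 subrr normr0.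
rewrite expgS; apply: le_trans (displacementM _ _ _) _.
by rewrite -natr1 mulrDl mul1r addrC lerD2r.
Qed.

Lemma cut_lambda (W : set (quot H)) g f :
  cut W (lambda R H g f) = lambda R H g (cut (quot_act g @^-1` W) f).
Proof.
apply/val_inj/funext => C /=.
suff -> : (quot_act g^-1%g C \in quot_act g @^-1` W) = (C \in W) by [].
by apply/idP/idP; rewrite !in_setE /preimage /= quot_actM mulgV quot_act1.
Qed.

(** Translating by [g] is an isometry that carries the part of [f] living on the
preimage of [W] to the part of [g f] living on [W], and restricting to [W] contracts
the difference [f - g f]. *)
Lemma cut_translate (W : set (quot H)) g f :
  `|cut W f| <= `|cut (quot_act g @^-1` W) f| + displacement f g.
Proof.
rewrite -(norm_lambda g (cut (quot_act g @^-1` W) f)) -cut_lambda -lerBlDl.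
apply: le_trans (norm_cut W _); rewrite cutB distrC.
exact: lerB_dist.
Qed.

(** If the positive powers of [g] carry [W] off itself, the nine sets
[g^-i W], [i < 9], are pairwise disjoint and [f] has nearly the same norm [w] on
each of them; orthogonality gives [9 w^2 <= 1] up to the displacement. *)
Lemma wandering_cut (W : set (quot H)) g f : `|f| = 1 ->
  (forall n C, W C -> ~ W (quot_act (g ^+ n.+1)%g C)) ->
  `|cut W f| <= 3^-1 + 9%:R * displacement f g.
Proof.
move=> f1 wand; set w := `|cut W f|; set d := displacement f g.
pose V (i : 'I_9) := quot_act (g ^+ i)%g @^-1` W.
have d0 : 0 <= d by exact: normr_ge0.
have Vle i : w - 9%:R * d <= `|cut (V i) f|.
  rewrite lerBlDr; apply: le_trans (cut_translate W (g ^+ i)%g f) _.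
  rewrite lerD2l; apply: le_trans (displacementX _ _ _) _.
  by rewrite ler_wpM2r// ler_nat ltnW.
have Vdis i j C : V i C -> V j C -> i = j.
  have aux (k l : 'I_9) : (k < l)%N -> V k C -> V l C -> False.
    move=> kl Vk; rewrite /V /preimage /= -(subnK kl) -addSnnS expgnDr.
    by rewrite -quot_actM; apply: wand.
  move=> Vi Vj; apply/val_inj; case: (ltngtP i j) => // ij.
  - by case: (aux _ _ ij Vi Vj).
  - by case: (aux _ _ ij Vj Vi).
have := norm_ge_disjoint f Vdis; rewrite f1 expr1n.
have [w9|w9] := leP w (9%:R * d); first by move=> _; lra.
move=> le1; have : \sum_(i < 9) (w - 9%:R * d) ^+ 2 <= 1.
  by apply: le_trans le1; apply: ler_sum => i _; rewrite ler_sqr ?nnegrE// subr_ge0 ltW.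
rewrite sumr_const card_ord -mulr_natl -lerBlDr; move: w9; rewrite -subr_gt0.
by move: (w - _) => y; nra.
Qed.

Lemma dilationX (q : quot H -> R) L g n C :
  (forall C, q (quot_act g C) = L * q C) ->
  q (quot_act (g ^+ n)%g C) = L ^+ n * q C.
Proof.
move=> qg; elim: n => [|n IHn]; first by rewrite expg0 quot_act1 mul1r.
by rewrite expgS -quot_actM qg IHn exprS mulrA.
Qed.

(** A shell between two level sets of a function that [g] multiplies by a constant
exceeding the ratio of the two levels is a wandering set. *)
Lemma dilation_cut (q : quot H -> R) (L r r' : R) g f :
  `|f| = 1 -> 0 < r -> 1 <= L -> r' < L * r ->
  (forall C, q (quot_act g C) = L * q C) ->
  `|cut [set C | r <= q C <= r'] f| <= 3^-1 + 9%:R * displacement f g.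
Proof.
move=> f1 r0 L1 r'L qg; apply: wandering_cut => // n C /= /andP[rq qr].
have L0 : 0 <= L by apply: le_trans L1.
rewrite (dilationX _ _ qg).
apply/negP; rewrite negb_and -!ltNge; apply/orP; right.
apply: lt_le_trans r'L _; rewrite exprS -mulrA ler_wpM2l//.
by apply: (le_trans rq); rewrite ler_peMl ?exprn_ege1// (le_trans (ltW r0) rq).
Qed.

End Displacement.

(** * Coverings of the plane and of the projective plane of sl2 by shells *)

Section Covers.
Variable R : realFieldType.
Implicit Types (x y k l e K : R).

Lemma ratio_bounds K y y' : 0 < K -> y' != 0 ->
  `|y| <= K * `|y'| -> `|y'| <= K * `|y| -> K^-1 <= `|y / y'| <= K.
Proof.
move=> K0 y'0 h1 h2; have n0 : 0 < `|y'| by rewrite normr_gt0.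
by rewrite normf_div ler_pdivlMr// ler_pdivrMr// ler_pdivrMl// h2.
Qed.

Lemma near_bounds x y : `|y - x| <= `|x| / 2 -> `|x| / 2 <= `|y| <= 2 * `|x|.
Proof.
move=> yx; have := ler_normD (y - x) x; have := ler_normD y (x - y).
by rewrite subrK addrC subrK (distrC x y) => *; apply/andP; split; lra.
Qed.

(** If [y] and [y'] agree with [x] and [x'] up to a factor of two, their quotients
agree up to a factor of four. *)
Lemma near_ratio K x x' y y' : x' != 0 ->
  `|y - x| <= `|x| / 2 -> `|y' - x'| <= `|x'| / 2 ->
  4 * `|x| <= K * `|x'| -> 4 * `|x'| <= K * `|x| -> K^-1 <= `|y / y'| <= K.
Proof.
move=> x'0 /near_bounds/andP[a1 a2] /near_bounds/andP[b1 b2] h1 h2.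
have p' : 0 < `|x'| by rewrite normr_gt0.
have K0 : 0 < K.
  rewrite ltNge; apply/negP => K0; have : K * `|x| <= 0 by rewrite mulr_le0_ge0.
  by lra.
apply: ratio_bounds => //; first by rewrite -normr_gt0; lra.
  apply: (@le_trans _ _ (2 * `|x|)) => //.
  by apply: (@le_trans _ _ (K * (`|x'| / 2))); [lra|rewrite ler_wpM2l// ltW].
apply: (@le_trans _ _ (2 * `|x'|)) => //.
by apply: (@le_trans _ _ (K * (`|x| / 2))); [lra|rewrite ler_wpM2l// ltW].
Qed.

(** [l] is the eigenvalue of a hyperbolic matrix [a], and [cr] the cross ratio of the
fixed points, on the projective line, of [a] and of a conjugate of [a]. *)
Variables (l cr : R).
Hypotheses (l6 : 6 <= l) (cr_le : `|cr| <= l ^+ 3) (cr_ge : 1 <= l ^+ 3 * `|cr|).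

Let l0 : 0 < l. Proof. by apply: lt_le_trans l6. Qed.
Let k0 : 0 < `|cr|.
Proof. by rewrite -(pmulr_rgt0 _ (exprn_gt0 3 l0)) (lt_le_trans ltr01). Qed.


Lemma expr_gap n x : 0 <= x -> 6 * (l ^+ n * x) <= l ^+ n.+1 * x.
Proof.
by move=> x0; rewrite exprS mulrA ler_wpM2r// ler_wpM2r// exprn_ge0// ltW.
Qed.

Lemma expr_mono n m x : (n <= m)%N -> 0 <= x -> l ^+ n * x <= l ^+ m * x.
Proof.
by move=> nm x0; rewrite ler_wpM2r// ler_weXn2l//; apply: le_trans l6; lra.
Qed.

Lemma expr_gap_le n x y : (0 < n)%N -> 0 <= x -> l ^+ n * x <= y -> 6 * x <= y.
Proof.
move=> n0 x0; apply: le_trans; apply: le_trans (expr_mono n0 x0).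
by have := expr_gap 0 x0; rewrite expr0 mul1r.
Qed.

Lemma small_after_cr n x y : 0 <= x -> l ^+ n.+4 * x <= y ->
  6 * (l ^+ n * (`|cr| * x)) <= y.
Proof.
move=> x0; apply: le_trans; apply: le_trans (expr_gap n.+3 x0).
rewrite ler_pM2l// -addn3 exprD -mulrA ler_wpM2l ?exprn_ge0 ?(ltW l0)//.
by rewrite ler_wpM2r.
Qed.

Lemma small_before_cr n x y : 0 <= x -> l ^+ n.+4 * x <= y ->
  6 * (l ^+ n * x) <= `|cr| * y.
Proof.
move=> x0 xy; apply: (@le_trans _ _ (`|cr| * (l ^+ n.+4 * x))); last first.
  by rewrite ler_wpM2l.
have -> : `|cr| * (l ^+ n.+4 * x) = l ^+ n.+1 * (l ^+ 3 * `|cr| * x).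
  by rewrite -(addn3 n.+1) exprD; ring.
apply: le_trans (expr_gap n x0) _.
by rewrite ler_wpM2l ?exprn_ge0 ?(ltW l0)// ler_peMl.
Qed.

Lemma cr_lower n x : (n >= 4)%N -> 0 <= x -> 4 * x <= l ^+ n * (`|cr| * x).
Proof.
move=> n4 x0; apply: (@le_trans _ _ (l ^+ 4 * (`|cr| * x))); last first.
  by apply: expr_mono; rewrite ?mulr_ge0.
have -> : l ^+ 4 * (`|cr| * x) = l * ((l ^+ 3 * `|cr|) * x) by ring.
have h : x <= l ^+ 3 * `|cr| * x by rewrite ler_peMl.
by apply: ler_pM => //; have := l6; lra.
Qed.

Lemma cr_upper n x : (n >= 4)%N -> 0 <= x -> 6 * (`|cr| * x) <= l ^+ n * x.
Proof.
move=> n4 x0; apply: le_trans (expr_mono n4 x0); apply: le_trans (expr_gap 3 x0).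
by rewrite ler_pM2l// ler_wpM2r.
Qed.

(** [U] and [V] are the eigencoordinates of [a], centred at its fixed point and
rescaled so that the eigencoordinates of the conjugate of [a] are, up to a scalar,
[U + V - e] and [U + cr V - e']. A point outside the first three shells is close,
in the projective plane, to one of the three fixed points of [a]: its centre, where
[U + V - e] has about the size of [e], or a point at infinity, where the quotient
of the two coordinates of the conjugate is about [1] or [1 / cr]. *)
Lemma plane_cover e e' (U V : R) : e != 0 -> `|e'| <= `|e| ->
  (l ^+ 4)^-1 <= `|U / V| <= l ^+ 4 \/
  l^-1 * `|e| <= `|U| <= l * `|e| \/
  l^-1 * `|e| <= `|V| <= l ^+ 4 * `|e| \/
  2^-1 * `|e| <= `|U + V - e| <= 2 * `|e| \/
  (l ^+ 4)^-1 <= `|(U + V - e) / (U + cr * V - e')| <= l ^+ 4.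
Proof.
move=> e0 e'e; have p0 : 0 < `|e| by rewrite normr_gt0.
have [VU|UV] := leP (l ^+ 4 * `|V|) `|U|.
- have s1 := le_trans (expr_mono (leq0n 4) (normr_ge0 V)) VU.
  have s2 := le_trans (expr_gap 3 (normr_ge0 V)) VU.
  have s3 := small_after_cr (normr_ge0 V) VU.
  rewrite !expr0 !mul1r -normrM in s1 s3.
  have s4 : 6 * `|V| <= `|U|.
    apply: le_trans VU; have := expr_gap 0 (normr_ge0 V).
    by have := @expr_mono 1 4 `|V| isT (normr_ge0 V); lra.
  have [U1|U1] := ltP `|U| (l^-1 * `|e|).
    have s5 : 6 * `|U| <= `|e|.
      by move: U1; rewrite ltr_pdivlMl// => /ltW; apply: le_trans; rewrite ler_wpM2r.
    do 3!right; left; rewrite [2^-1 * _]mulrC -(normrN e); apply: near_bounds.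
    rewrite opprK subrK normrN; apply: le_trans (ler_normD _ _) _; lra.
  have [U2|U2] := leP `|U| (l * `|e|); first by (right; left).
  have s6 : 6 * `|e| <= `|U|.
    by apply: le_trans (ltW U2); rewrite ler_wpM2r.
  have U0 : U != 0 by rewrite -normr_gt0; lra.
  have l4 : 4 <= l ^+ 4.
    by have := @expr_mono 1 4 1 isT ler01; rewrite !mulr1 expr1; have := l6; lra.
  do 4!right; apply: (near_ratio (x := U) (x' := U)) => //.
  + rewrite (_ : U + V - e - U = V - e); last by ring.
    by apply: le_trans (ler_normB _ _) _; lra.
  + rewrite (_ : U + cr * V - e' - U = cr * V - e'); last by ring.
    by apply: le_trans (ler_normB _ _) _; lra.
  + by rewrite ler_wpM2r.
  + by rewrite ler_wpM2r.
have [UV'|VU] := leP (l ^+ 4 * `|U|) `|V|; last first.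
  have V0 : V != 0.
    by apply: contraTneq UV => ->; rewrite normr0 mulr0 -leNgt.
  by left; apply: ratio_bounds; rewrite ?exprn_gt0// ltW.
have V0 : 0 < `|V|.
  rewrite normr_gt0; apply: contraTneq UV => ->.
  by rewrite normr0 mulr0 -leNgt.
have s1 : 6 * `|U| <= `|V|.
  apply: le_trans UV'; have := expr_gap 0 (normr_ge0 U).
  by have := @expr_mono 1 4 `|U| isT (normr_ge0 U); lra.
have s2 := small_before_cr (normr_ge0 U) UV'; rewrite expr0 mul1r -normrM in s2.
have [V1|V1] := ltP `|V| (l^-1 * `|e|).
  have s5 : 6 * `|V| <= `|e|.
    by move: V1; rewrite ltr_pdivlMl// => /ltW; apply: le_trans; rewrite ler_wpM2r.
  do 3!right; left; rewrite [2^-1 * _]mulrC -(normrN e); apply: near_bounds.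
  by rewrite opprK subrK normrN; apply: le_trans (ler_normD _ _) _; lra.
have [V2|/ltW V2] := leP `|V| (l ^+ 4 * `|e|); first by (do 2!right; left).
have s3 : 6 * `|e| <= `|V|.
  apply: le_trans V2; have := expr_gap 0 (normr_ge0 e).
  by have := @expr_mono 1 4 `|e| isT (normr_ge0 e); lra.
have s4 := small_before_cr (normr_ge0 e) V2; rewrite expr0 mul1r -normrM in s4.
do 4!right; apply: (near_ratio (x := V) (x' := cr * V)) => //.
- by rewrite -normr_gt0 normrM mulr_gt0.
- rewrite (_ : U + V - e - V = U - e); last by ring.
  by apply: le_trans (ler_normB _ _) _; lra.
- rewrite (_ : U + cr * V - e' - cr * V = U - e'); last by ring.
  by apply: le_trans (ler_normB _ _) _; lra.
- by apply: le_trans (@cr_lower 4 _ isT (normr_ge0 V)) _; rewrite normrM.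
- rewrite normrM; apply: le_trans (@cr_upper 4 _ isT (normr_ge0 V)).
  by have := mulr_ge0 (normr_ge0 cr) (normr_ge0 V); lra.
Qed.

(** The same covering for the adjoint action. [Y], [X] and [Z] are the coordinates of
an element of sl2 on the three eigenlines of [a], rescaled so that its extreme
coordinates for the conjugate of [a] are, up to scalars, [Y - 2 X - Z] and
[Y - 2 cr X - cr^2 Z]. Outside the first three shells one of
the three coordinates dominates, and the quotient for the conjugate is then about
[1], [1 / cr] or [1 / cr^2]. *)
Lemma sl2_cover (X Y Z : R) : [|| X != 0, Y != 0 | Z != 0] ->
  (l ^+ 7)^-1 <= `|Y / Z| <= l ^+ 7 \/
  (l ^+ 4)^-1 <= `|Y / X| <= l ^+ 4 \/
  (l ^+ 4)^-1 <= `|X / Z| <= l ^+ 4 \/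
  (l ^+ 7)^-1 <= `|(Y - 2 * X - Z) / (Y - 2 * cr * X - cr ^+ 2 * Z)| <= l ^+ 7.
Proof.
move=> nz.
have X_dominates : X != 0 -> l ^+ 4 * `|Y| <= `|X| -> l ^+ 4 * `|Z| <= `|X| ->
  (l ^+ 7)^-1 <= `|(Y - 2 * X - Z) / (Y - 2 * cr * X - cr ^+ 2 * Z)| <= l ^+ 7.
  move=> X0 YX ZX; have X0' : 0 < `|X| by rewrite normr_gt0.
  have y1 := @expr_gap_le 4 _ _ isT (normr_ge0 Y) YX.
  have z1 := @expr_gap_le 4 _ _ isT (normr_ge0 Z) ZX.
  have y2 := small_before_cr (normr_ge0 Y) YX.
  have z2 := ler_wpM2l (ltW k0) (small_after_cr (normr_ge0 Z) ZX).
  rewrite !expr0 !mul1r in y2 z2.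
  have nX : `|- 2 * X| = 2 * `|X| by rewrite normrM normrN normr_nat.
  have nkX : `|- 2 * cr * X| = 2 * (`|cr| * `|X|).
    by rewrite !normrM normrN normr_nat mulrA.
  apply: (near_ratio (x := - 2 * X) (x' := - 2 * cr * X)).
  - by rewrite -normr_gt0 nkX !mulr_gt0.
  - rewrite nX (_ : Y - 2 * X - Z - _ = Y - Z); last by ring.
    by apply: le_trans (ler_normB _ _) _; lra.
  - rewrite nkX (_ : Y - _ - _ - _ = Y - cr ^+ 2 * Z); last by ring.
    apply: le_trans (ler_normB _ _) _; rewrite normrM normrX expr2 -mulrA.
    by have := mulr_gt0 k0 X0'; lra.
  - by rewrite nX nkX; have := @cr_lower 7 _ isT (normr_ge0 X); lra.
  - by rewrite nX nkX; have := @cr_upper 7 _ isT (normr_ge0 X);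
      have := mulr_gt0 k0 X0'; lra.
have Y_dominates : Y != 0 -> l ^+ 4 * `|X| <= `|Y| -> l ^+ 7 * `|Z| <= `|Y| ->
  (l ^+ 7)^-1 <= `|(Y - 2 * X - Z) / (Y - 2 * cr * X - cr ^+ 2 * Z)| <= l ^+ 7.
  move=> Y0 XY ZY.
  have x1 := @expr_gap_le 4 _ _ isT (normr_ge0 X) XY.
  have z1 := @expr_gap_le 7 _ _ isT (normr_ge0 Z) ZY.
  have x2 := small_after_cr (normr_ge0 X) XY.
  have z2 : 6 * (`|cr| * (`|cr| * `|Z|)) <= `|Y|.
    have := small_after_cr (normr_ge0 Z) ZY; apply: le_trans; rewrite ler_pM2l//.
    by rewrite ler_wpM2r ?mulr_ge0.
  rewrite expr0 mul1r in x2.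
  apply: (near_ratio (x := Y) (x' := Y)) => //.
  - rewrite (_ : Y - 2 * X - Z - Y = - (2 * X + Z)); last by ring.
    rewrite normrN; apply: le_trans (ler_normD _ _) _.
    by rewrite normrM normr_nat; lra.
  - rewrite (_ : _ - _ - _ - Y = - (2 * cr * X + cr ^+ 2 * Z)); last by ring.
    rewrite normrN; apply: le_trans (ler_normD _ _) _.
    by rewrite !normrM !normr_nat; lra.
  - by have := @expr_gap_le 7 _ _ isT (normr_ge0 Y) (lexx _); have := normr_ge0 Y; lra.
  - by have := @expr_gap_le 7 _ _ isT (normr_ge0 Y) (lexx _); have := normr_ge0 Y; lra.
have Z_dominates : Z != 0 -> l ^+ 4 * `|X| <= `|Z| -> l ^+ 7 * `|Y| <= `|Z| ->
  (l ^+ 7)^-1 <= `|(Y - 2 * X - Z) / (Y - 2 * cr * X - cr ^+ 2 * Z)| <= l ^+ 7.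
  move=> Z0 XZ YZ; have Z0' : 0 < `|Z| by rewrite normr_gt0.
  have x1 := @expr_gap_le 4 _ _ isT (normr_ge0 X) XZ.
  have y1 := @expr_gap_le 7 _ _ isT (normr_ge0 Y) YZ.
  have x2 := ler_wpM2l (ltW k0) (small_before_cr (normr_ge0 X) XZ).
  have y2 := small_before_cr (normr_ge0 Y) YZ.
  have {}y2 : `|Y| * 6 <= `|cr| * (`|cr| * `|Z|).
    apply: le_trans (ler_wpM2l (ltW k0) y2).
    have -> : `|cr| * (6 * (l ^+ 3 * `|Y|)) = (l ^+ 3 * `|cr|) * (`|Y| * 6) by ring.
    by rewrite ler_peMl// mulr_ge0.
  rewrite expr0 mul1r in x2.
  have nkZ : `|- cr ^+ 2 * Z| = `|cr| * (`|cr| * `|Z|).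
    by rewrite normrM normrN normrX expr2 mulrA.
  apply: (near_ratio (x := - Z) (x' := - cr ^+ 2 * Z)).
  - by rewrite -normr_gt0 nkZ !mulr_gt0.
  - rewrite normrN (_ : Y - _ - Z - _ = Y - 2 * X); last by ring.
    by apply: le_trans (ler_normB _ _) _; rewrite normrM normr_nat; lra.
  - rewrite nkZ (_ : Y - _ - _ - _ = Y - 2 * cr * X); last by ring.
    by apply: le_trans (ler_normB _ _) _; rewrite !normrM normr_nat; lra.
  - rewrite normrN nkZ; apply: le_trans (@cr_lower 4 _ isT (normr_ge0 Z)) _.
    have -> : l ^+ 7 * (`|cr| * (`|cr| * `|Z|)) =
      l ^+ 4 * ((l ^+ 3 * `|cr|) * (`|cr| * `|Z|)) by ring.
    by rewrite ler_wpM2l ?exprn_ge0 ?(ltW l0)// ler_peMl// mulr_ge0.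
  - have kz0 : 0 <= `|cr| * `|Z| by rewrite mulr_ge0.
    have h := @cr_upper 4 _ isT kz0; rewrite normrN nkZ.
    apply: (@le_trans _ _ (l ^+ 4 * (`|cr| * `|Z|))).
      by have := mulr_ge0 (ltW k0) kz0; lra.
    rewrite (exprD _ 4 3) -mulrA ler_wpM2l ?exprn_ge0 ?(ltW l0)//.
    by rewrite ler_wpM2r.
have [ZY|YZ] := leP (l ^+ 7 * `|Z|) `|Y|.
  have ZY' : `|Z| <= `|Y|.
    by apply: le_trans ZY; have := @expr_mono 0 7 _ isT (normr_ge0 Z); rewrite expr0 mul1r.
  have [YX|XY] := leP (l ^+ 4 * `|Y|) `|X|.
    do 3!right; apply: X_dominates => //; last first.
      by apply: le_trans YX; rewrite ler_wpM2l// exprn_ge0// ltW.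
    apply/eqP => X0; move: YX nz; rewrite X0 normr0 pmulr_rle0 ?exprn_gt0//.
    rewrite normr_le0 => /eqP Y0; move: ZY'.
    by rewrite Y0 normr0 normr_le0 => /eqP ->; rewrite eqxx.
  have Y0 : Y != 0 by apply: contraTneq XY => ->; rewrite normr0 mulr0 -leNgt.
  have [XY'|YX] := leP (l ^+ 4 * `|X|) `|Y|; first by do 3!right; apply: Y_dominates.
  right; left; apply: ratio_bounds; rewrite ?exprn_gt0 ?(ltW XY) ?(ltW YX)//.
  by apply: contraTneq YX => ->; rewrite normr0 mulr0 -leNgt.
have Z0 : Z != 0 by apply: contraTneq YZ => ->; rewrite normr0 mulr0 -leNgt.
have [YZ'|ZY] := leP (l ^+ 7 * `|Y|) `|Z|; last first.
  by left; apply: ratio_bounds; rewrite ?exprn_gt0 ?(ltW YZ) ?(ltW ZY).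
have YZ'' : `|Y| <= `|Z|.
  by apply: le_trans YZ'; have := @expr_mono 0 7 _ isT (normr_ge0 Y); rewrite expr0 mul1r.
have [ZX|XZ] := leP (l ^+ 4 * `|Z|) `|X|.
  do 3!right; apply: X_dominates => //; last first.
    by apply: le_trans ZX; rewrite ler_wpM2l// exprn_ge0// ltW.
  apply: contraTneq ZX => ->; rewrite normr0 -ltNge mulr_gt0 ?exprn_gt0//.
  by rewrite normr_gt0.
have [XZ'|ZX] := leP (l ^+ 4 * `|X|) `|Z|; first by do 3!right; apply: Z_dominates.
by do 2!right; left; apply: ratio_bounds; rewrite ?exprn_gt0 ?(ltW XZ) ?(ltW ZX).
Qed.
End Covers.

(** * Two-by-two matrices *)

Section Matrix2.
Variable F : comNzRingType.
Implicit Types A B : 'M[F]_2.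

Lemma mulmx2E n A (B : 'M[F]_(2, n)) i j : (A *m B) i j = A i 0 * B 0 j + A i 1 * B 1 j.
Proof. by rewrite !mxE big_ord_recl big_ord1; congr (_ + A i _ * B _ j); apply: val_inj. Qed.

Lemma mxtrace2E A : \tr A = A 0 0 + A 1 1.
Proof. by rewrite /mxtrace big_ord_recl big_ord1; congr (_ + A _ _); apply: val_inj. Qed.

Lemma det2E A : \det A = A 0 0 * A 1 1 - A 0 1 * A 1 0.
Proof.
rewrite (expand_det_row _ 0) big_ord_recl big_ord1.
rewrite /cofactor !det_mx11 !mxE /= expr0 expr1 mul1r mulN1r mulrN.
by congr (_ * A _ _ - A _ _ * A _ _); apply: val_inj.
Qed.

Lemma I2_cases (k : 'I_2) : k = 0 \/ k = 1.
Proof. by case: k => -[|[|//]] ?; [left|right]; apply: val_inj. Qed.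

Lemma mx2_eq A B : A 0 0 = B 0 0 -> A 0 1 = B 0 1 -> A 1 0 = B 1 0 ->
  A 1 1 = B 1 1 -> A = B.
Proof.
move=> h00 h01 h10 h11; apply/matrixP => i j.
by have [->|->] := I2_cases i; have [->|->] := I2_cases j.
Qed.

Lemma cV2_eq (v w : 'cV[F]_2) : v 0 0 = w 0 0 -> v 1 0 = w 1 0 -> v = w.
Proof.
move=> h0 h1; apply/matrixP => i j; rewrite (ord1 j).
by have [->|->] := I2_cases i.
Qed.

Definition mx2 (a b c d : F) : 'M[F]_2 :=
  \matrix_(i, j) if i == 0 then (if j == 0 then a else b)
                 else (if j == 0 then c else d).

Lemma mx2_entries a b c d : (mx2 a b c d 0 0 = a) * (mx2 a b c d 0 1 = b) *
  (mx2 a b c d 1 0 = c) * (mx2 a b c d 1 1 = d).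
Proof. by rewrite !mxE. Qed.

Lemma adj2E A : (\adj A 0 0 = A 1 1) * (\adj A 0 1 = - A 0 1) *
  (\adj A 1 0 = - A 1 0) * (\adj A 1 1 = A 0 0).
Proof.
rewrite !mxE /cofactor !det_mx11 !mxE /= ?addn0 ?addn1 ?expr0 ?expr1 ?sqrrN ?expr1n ?mul1r ?mulN1r.
by do !split; (congr (A _ _) || congr (- (A _ _))); apply: val_inj.
Qed.

Lemma addmx2E n (A B : 'M[F]_(2, n)) i j : (A + B) i j = A i j + B i j.
Proof. by rewrite mxE. Qed.

Lemma oppmx2E n (A : 'M[F]_(2, n)) i j : (- A) i j = - A i j.
Proof. by rewrite mxE. Qed.

Lemma scalemx2E n k (A : 'M[F]_(2, n)) i j : (k *: A) i j = k * A i j.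
Proof. by rewrite mxE. Qed.

Lemma scalar_mx2E k : (@scalar_mx F 2 k 0 0 = k) * (@scalar_mx F 2 k 0 1 = 0) *
  (@scalar_mx F 2 k 1 0 = 0) * (@scalar_mx F 2 k 1 1 = k).
Proof. by rewrite !mxE. Qed.

End Matrix2.

Definition mx2E := (mx2_entries, mulmx2E, mxtrace2E, det2E, adj2E,
  addmx2E, oppmx2E, scalemx2E, scalar_mx2E).

(** * Normalizers of lines of sl2 *)

(** For [T] in SL2, conjugation by [T] preserves the line spanned by [X]; written
without inverses, so that it makes sense for all [T]. *)
Definition normalizes_line (F : comNzRingType) (X T : 'M[F]_2) : Prop :=
  exists k, T *m X = k *: (X *m T).

Section NormalizesLine.
Variable F : fieldType.
Implicit Types X T U : 'M[F]_2.

Lemma normalizes_line1 X : normalizes_line X 1%:M.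
Proof. by exists 1; rewrite mul1mx mulmx1 scale1r. Qed.

Lemma normalizes_lineM X T U :
  normalizes_line X T -> normalizes_line X U -> normalizes_line X (T *m U).
Proof.
move=> [k TX] [l UX]; exists (l * k).
by rewrite -(mulmxA T) UX -scalemxAr (mulmxA T) TX -scalemxAl scalerA mulmxA.
Qed.

Lemma normalizes_line_adj X T : X != 0 -> \det T = 1 ->
  normalizes_line X T -> normalizes_line X (\adj T).
Proof.
move=> X0 dT [k TX]; have aT : \adj T *m T = 1%:M by rewrite mul_adj_mx dT.
have Ta : T *m \adj T = 1%:M by rewrite mul_mx_adj dT.
have XE : X = k *: (\adj T *m X *m T).
  by rewrite -[LHS]mul1mx -aT -(mulmxA _ T X) TX -scalemxAr mulmxA.
have k0 : k != 0 by apply: contraNneq X0 => k0; rewrite XE k0 scale0r.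
exists k^-1; rewrite {2}XE -scalemxAl -!mulmxA Ta mulmx1 scalerA mulVf//.
by rewrite scale1r.
Qed.

(** The scalars by which two normalizers of the line act commute, so that a commutator
acts trivially. [C] stands for the commutator of [T] and [U]. *)
Lemma normalizes_line_comm X T U C : \det T = 1 -> \det U = 1 ->
  normalizes_line X T -> normalizes_line X U ->
  U *m T *m C = T *m U -> C *m X = X *m C.
Proof.
move=> dT dU [k TX] [l UX] CE.
have inv : \adj (U *m T) *m (U *m T) = 1%:M.
  by rewrite mul_adj_mx det_mulmx dT dU mulr1.
have UTX : U *m T *m X = (k * l) *: (X *m (U *m T)).
  by rewrite -(mulmxA U) TX -scalemxAr (mulmxA U) UX -scalemxAl scalerA mulmxA.
have TUX : T *m U *m X = (k * l) *: (X *m (T *m U)).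
  by rewrite -(mulmxA T) UX -scalemxAr (mulmxA T) TX -scalemxAl scalerA mulmxA mulrC.
rewrite -[LHS]mul1mx -[RHS]mul1mx -inv -!(mulmxA (\adj _)); congr (_ *m _).
by rewrite !mulmxA CE TUX -CE -mulmxA UTX -scalemxAl !mulmxA.
Qed.

End NormalizesLine.

(** [T], [U] and [X] have proportional traceless parts, because [X] spans its own
centralizer in sl2. *)
Lemma centralizer_comm (F : realFieldType) (X T U : 'M[F]_2) :
  X != 0 -> \tr X = 0 -> T *m X = X *m T -> U *m X = X *m U ->
  T *m U = U *m T.
Proof.
move=> X0 trX TX UX; have X11 : X 1 1 = - X 0 0.
  by apply/eqP; rewrite -addr_eq0 addrC -mxtrace2E trX.
have eqs (V : 'M[F]_2) : V *m X = X *m V ->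
  [/\ V 0 1 * X 1 0 = X 0 1 * V 1 0,
      X 0 1 * (V 0 0 - V 1 1) = 2 * X 0 0 * V 0 1 &
      X 1 0 * (V 0 0 - V 1 1) = 2 * X 0 0 * V 1 0].
  move=> /matrixP VX; have := (VX 0 0, VX 0 1, VX 1 0).
  by rewrite !mx2E X11 => -[[h00 h01] h10]; split; lra.
have [t1 t2 t3] := eqs _ TX; have [u1 u2 u3] := eqs _ UX.
pose P01 := T 0 1 * U 1 0 - U 0 1 * T 1 0.
pose P02 := T 0 1 * (U 0 0 - U 1 1) - U 0 1 * (T 0 0 - T 1 1).
pose P12 := T 1 0 * (U 0 0 - U 1 1) - U 1 0 * (T 0 0 - T 1 1).
suff [p01 p02 p12] : [/\ P01 = 0, P02 = 0 & P12 = 0].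
  by rewrite /P01 /P02 /P12 in p01 p02 p12; apply: mx2_eq; rewrite !mx2E; lra.
have [y0|y0] := eqVneq (X 0 1) 0; last first.
  have p01 : P01 = 0.
    apply: (mulfI y0); rewrite mulr0.
    rewrite [LHS](_ : _ = U 0 1 * (T 0 1 * X 1 0 - X 0 1 * T 1 0) -
      T 0 1 * (U 0 1 * X 1 0 - X 0 1 * U 1 0)); last by rewrite /P01; ring.
    by rewrite t1 u1 !subrr !mulr0 subrr.
  have p02 : P02 = 0.
    apply: (mulfI y0); rewrite mulr0.
    rewrite [LHS](_ : _ = T 0 1 * (X 0 1 * (U 0 0 - U 1 1)) -
      U 0 1 * (X 0 1 * (T 0 0 - T 1 1))); last by rewrite /P02; ring.
    by rewrite t2 u2; ring.
  split=> //; apply: (mulfI y0); rewrite mulr0.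
  rewrite [LHS](_ : _ = T 1 0 * (X 0 1 * (U 0 0 - U 1 1)) -
      U 1 0 * (X 0 1 * (T 0 0 - T 1 1))); last by rewrite /P12; ring.
  rewrite t2 u2 (_ : _ - _ = - (2 * X 0 0) * P01); last by rewrite /P01; ring.
  by rewrite p01 mulr0.
have [z0|z0] := eqVneq (X 1 0) 0; last first.
  have T01 : T 0 1 = 0 by apply: (mulIf z0); rewrite mul0r t1 y0 mul0r.
  have U01 : U 0 1 = 0 by apply: (mulIf z0); rewrite mul0r u1 y0 mul0r.
  rewrite /P01 /P02 /P12 T01 U01; split; [ring|ring|].
  apply: (mulfI z0); rewrite mulr0.
  rewrite [LHS](_ : _ = T 1 0 * (X 1 0 * (U 0 0 - U 1 1)) -
    U 1 0 * (X 1 0 * (T 0 0 - T 1 1))); last by ring.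
  by rewrite t3 u3; ring.
have x0 : X 0 0 != 0.
  apply: contraNneq X0 => x0; apply/eqP; apply: mx2_eq; rewrite mxE //.
  by rewrite X11 x0 oppr0.
have x20 : 2 * X 0 0 != 0 by rewrite mulf_neq0// pnatr_eq0.
have off (V : 'M[F]_2) : X 0 1 * (V 0 0 - V 1 1) = 2 * X 0 0 * V 0 1 ->
    X 1 0 * (V 0 0 - V 1 1) = 2 * X 0 0 * V 1 0 -> V 0 1 = 0 /\ V 1 0 = 0.
  by rewrite y0 z0 mul0r => h1 h2; split; apply: (mulfI x20); rewrite mulr0.
have [T01 T10] := off _ t2 t3; have [U01 U10] := off _ u2 u3.
by rewrite /P01 /P02 /P12 T01 U01 T10 U10; split; ring.
Qed.

Section GroupMorphism.
Variables (gT rT : groupType) (rho : gT -> rT).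
Hypothesis rhoM : forall x y, rho (x * y)%g = (rho x * rho y)%g.

Lemma morphism1 : rho 1%g = 1%g.
Proof. by apply: (@mulgI _ (rho 1%g)); rewrite -rhoM !mulg1. Qed.

Lemma morphismV x : rho x^-1%g = (rho x)^-1%g.
Proof. by apply: (@mulgI _ (rho x)); rewrite -rhoM !mulgV morphism1. Qed.
End GroupMorphism.

Section SolvableCriterion.
Variables (R : realType) (gT : groupType) (rho : gT -> SA R).
Hypothesis rhoM : forall x y, rho (x * y)%g = (rho x * rho y)%g.
Hypothesis rho_inj : injective rho.

Lemma derived_sub (K : subgroup gT) (A : set gT) :
  (forall x y, A x -> A y -> carrier K [~ x, y]%g) -> derived A `<=` K.
Proof. by move=> AK z; apply=> _ [x [y [Ax Ay ->]]]; exact: AK. Qed.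

Lemma thetaM (g h : SA R) : theta (g * h)%g = theta g *m theta h.
Proof. by []. Qed.

Lemma theta_comm x y : theta (rho y) *m theta (rho x) *m theta (rho [~ x, y]%g) =
  theta (rho x) *m theta (rho y).
Proof.
rewrite -!thetaM -!rhoM; congr (theta (rho _)).
by rewrite commgEl conjgE !mulgA mulgK mulgV mul1g.
Qed.

Definition commutant_subgroup (X : 'M[R]_2) : subgroup gT.
Proof.
apply: (@Subgroup _ [set g | theta (rho g) *m X = X *m theta (rho g)]) => /=.
- by rewrite (morphism1 rhoM) mul1mx mulmx1.
- by move=> x y hx hy; rewrite rhoM thetaM -mulmxA hy mulmxA hx mulmxA.
move=> x hx; rewrite (morphismV rhoM).
have [aT Ta] := (adj_thetaK (rho x), theta_adjK (rho x)).
rewrite -[RHS]mul1mx -aT -!(mulmxA (\adj _)); congr (_ *m _).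
by rewrite mulmxA hx -mulmxA Ta mulmx1.
Defined.

Definition linear_kernel : subgroup gT.
Proof.
apply: (@Subgroup _ [set g | theta (rho g) = 1%:M]) => /=.
- by rewrite (morphism1 rhoM).
- by move=> x y hx hy; rewrite rhoM thetaM hx hy mulmx1.
by move=> x hx; rewrite (morphismV rhoM) -[LHS]mulmx1 -hx adj_thetaK.
Defined.

Definition full_subgroup : subgroup gT := @Subgroup _ setT I (fun _ _ _ _ => I) (fun _ _ => I).

Definition trivial_subgroup : subgroup gT.
Proof.
apply: (@Subgroup _ [set 1%g]) => //= [x y -> ->|x ->]; first by rewrite mulg1.
exact: invg1.
Defined.

(** The first derived group centralizes [X], so that the second one consists of
translations, and the third one is trivial. *)
Lemma solvable_of_line (X : 'M[R]_2) : X != 0 -> \tr X = 0 ->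
  (forall g, normalizes_line X (theta (rho g))) -> virtually_solvable gT.
Proof.
move=> X0 trX nX; exists full_subgroup.
  suff -> : left_cosets full_subgroup = [set setT] by exact: finite_set1.
  apply/seteqP; split=> [_ [x _ <-]|_ ->] /=.
    apply/seteqP; split=> // y _; exists (x^-1 * y)%g => //.
    by rewrite mulgA mulgV mul1g.
  exists 1%g => //; exact: left_coset1.
have sub1 : derived setT `<=` commutant_subgroup X.
  apply: derived_sub => x y _ _ /=.
  by apply: normalizes_line_comm (theta_comm x y); rewrite ?det_theta.
have sub2 : derived (derived setT) `<=` linear_kernel.
  apply: derived_sub => x y /sub1 hx /sub1 hy /=.
  have hxy := centralizer_comm X0 trX hx hy.
  have inv := adj_thetaK (rho y * rho x)%g; rewrite thetaM in inv.
  by rewrite -[LHS]mul1mx -inv -mulmxA theta_comm hxy.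
exists 3%N => /=; apply/seteqP; split=> [z|_ ->]; last first.
  by move=> K _; exact: subgroup1.
move=> /(_ trivial_subgroup); apply=> _ [x [y [/sub2 hx /sub2 hy ->]]] /=.
have xy : (x * y = y * x)%g.
  apply: rho_inj; rewrite !rhoM; apply: SA_eq; rewrite ?thetaM ?hx ?hy//.
  by rewrite /tau /= -/(theta _) -/(tau _) hx hy !mul1mx addrC.
by apply: (@mulgI _ (y * x)%g); rewrite mulg1 commgEl conjgE !mulgA mulgK mulgV mul1g.
Qed.
End SolvableCriterion.

(** * Traces of commutators in SL2 *)

Section CommutatorTrace.
Variable F : comNzRingType.
Implicit Types s t : 'M[F]_2.

Lemma det_eq1 (C : 'M[F]_2) : \det C = 1 -> C 0 0 * C 1 1 = 1 + C 0 1 * C 1 0.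
Proof. by rewrite det2E => <-; rewrite subrK. Qed.

Lemma det_sub1 (C : 'M[F]_2) : \det C = 1 -> \det (C - 1%:M) = 2 - \tr C.
Proof.
by move=> /det_eq1 dC; rewrite !mx2E; ring: dC.
Qed.

(** [s t - t s = (C - 1) t s] for the commutator [C], and the characteristic
polynomial of [C] at [1] is [2 - tr C]. *)
Lemma trace_commutator s t : \det s = 1 -> \det t = 1 ->
  \tr (s *m t *m \adj s *m \adj t) = 2 - \det (s *m t - t *m s).
Proof.
move=> ds dt; set C := (X in \tr X).
have dadj (u : 'M[F]_2) : \det u = 1 -> \det (\adj u) = 1.
  by rewrite !mx2E => <-; ring.
have CE : (C - 1%:M) *m (t *m s) = s *m t - t *m s.
  rewrite mulmxBl mul1mx /C -!mulmxA (mulmxA (\adj t)) mul_adj_mx dt mul1mx.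
  by rewrite mul_adj_mx ds mulmx1.
have dC : \det C = 1 by rewrite !det_mulmx !dadj// ds dt !mulr1.
by rewrite -CE det_mulmx det_sub1// det_mulmx ds dt !mulr1 subKr.
Qed.

Lemma trace_sqr s : \det s = 1 -> \tr (s *m s) = \tr s ^+ 2 - 2.
Proof. by move=> /det_eq1 ds; rewrite !mx2E; ring: ds. Qed.

End CommutatorTrace.

Section TracelessPart.
Variable F : realFieldType.
Implicit Types s t : 'M[F]_2.

Definition traceless s : 'M[F]_2 := s - (\tr s / 2)%:M.

Lemma tr_traceless s : \tr (traceless s) = 0.
Proof. by rewrite /traceless !mx2E; lra. Qed.

Lemma tracelessE s : (traceless s 0 0 = (s 0 0 - s 1 1) / 2) *
  (traceless s 0 1 = s 0 1) * (traceless s 1 0 = s 1 0) *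
  (traceless s 1 1 = - ((s 0 0 - s 1 1) / 2)).
Proof. by rewrite /traceless !mx2E; do !split; lra. Qed.

(** The traceless parts [s0] of [s] and [N] of [s t - t s] are orthogonal for the trace
form of sl2, which has signature (2, 1). As [s] is not hyperbolic, [s0] is
isotropic or negative, so that the form is nonnegative on its orthogonal, and
vanishes there only on multiples of [s0]. *)
Lemma nonhyperbolic_commutator s t : \det s = 1 -> \det t = 1 ->
  traceless s != 0 -> \tr s ^+ 2 <= 4 ->
  \det (s *m t - t *m s) <= 0 /\
  (\det (s *m t - t *m s) = 0 -> normalizes_line (traceless s) t).
Proof.
move=> ds dt s0 trs.
set x := (s 0 0 - s 1 1) / 2; set y := s 0 1; set z := s 1 0.
have disc : x ^+ 2 + y * z <= 0.
  by rewrite -(ler_pM2l (ltr0n _ 4)) mulr0 /x /y /z; move: ds trs; rewrite !mx2E; nra.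
pose n1 := y * t 1 0 - t 0 1 * z.
pose n2 := 2 * x * t 0 1 + y * (t 1 1 - t 0 0).
pose n3 := z * (t 0 0 - t 1 1) - 2 * x * t 1 0.
have dE : \det (s *m t - t *m s) = - (n1 ^+ 2 + n2 * n3).
  by rewrite !mx2E /n1 /n2 /n3 /x /y /z; field.
(* completing the square by means of the orthogonality 2 x n1 + y n3 + z n2 = 0 *)
have yE : y ^+ 2 * (n1 ^+ 2 + n2 * n3) =
    (y * n1 - x * n2) ^+ 2 - (x ^+ 2 + y * z) * n2 ^+ 2.
  by rewrite /n1 /n2 /n3; ring.
have s0E : traceless s = mx2 x y z (- x).
  by apply: mx2_eq; rewrite !tracelessE !mx2E.
rewrite dE oppr_le0.
have [y0|y0] := eqVneq y 0.
  have x0 : x = 0.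
    apply/eqP; rewrite -sqrf_eq0 eq_le sqr_ge0 andbT.
    by move: disc; rewrite y0 mul0r addr0.
  have n20 : n2 = 0 by rewrite /n2 y0 x0; ring.
  rewrite n20 mul0r addr0; split; first exact: sqr_ge0.
  have z0 : z != 0.
    apply: contraNneq s0 => z0; rewrite s0E x0 y0 z0; apply/eqP.
    by apply: mx2_eq; rewrite !mx2E ?mxE ?oppr0.
  move=> /eqP; rewrite oppr_eq0 sqrf_eq0 /n1 y0 mul0r sub0r oppr_eq0 mulf_eq0 (negPf z0) orbF.
  move=> /eqP t01; have t00 := det_eq1 dt; rewrite t01 mul0r addr0 in t00.
  exists (t 1 1 ^+ 2); rewrite s0E x0 y0.
  by apply: mx2_eq; rewrite !mx2E ?t01; ring: t00.
have y20 : 0 < y ^+ 2 by rewrite exprn_even_gt0.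
have E0 : 0 <= n1 ^+ 2 + n2 * n3.
  rewrite -(pmulr_rge0 _ y20) yE subr_ge0 (le_trans _ (sqr_ge0 _))//.
  by rewrite mulr_le0_ge0 ?sqr_ge0.
split=> // /eqP; rewrite oppr_eq0 => /eqP E; move: yE; rewrite E mulr0 => /esym/eqP.
have d0 : 0 <= - ((x ^+ 2 + y * z) * n2 ^+ 2) by rewrite -mulNr mulr_ge0 ?sqr_ge0 ?oppr_ge0.
rewrite paddr_eq0 ?sqr_ge0// sqrf_eq0 oppr_eq0 mulf_eq0 sqrf_eq0 subr_eq0.
move=> /andP[/eqP n12 /orP[/eqP disc0|/eqP n20]].
(* s0 is nilpotent: t multiplies its column space by mu and its row space by nu *)
- pose mu := (t 0 0 * y - t 0 1 * x) / y; pose nu := (t 0 1 * x + t 1 1 * y) / y.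
  have zE : z = - x ^+ 2 / y.
    by apply: (mulfI y0); rewrite mulrCA divff// mulr1; lra.
  have cE2 : y ^+ 2 * t 1 0 = x * (t 0 1 * x + t 1 1 * y - t 0 0 * y).
    apply/eqP; rewrite -subr_eq0.
    have -> : y ^+ 2 * t 1 0 - x * (t 0 1 * x + t 1 1 * y - t 0 0 * y) =
      (y * n1 - x * n2) + t 0 1 * (x ^+ 2 + y * z) by rewrite /n1 /n2; ring.
    by rewrite n12 subrr add0r disc0 mulr0.
  have cE : t 1 0 = x * (nu - t 0 0) / y.
    apply: (mulfI (lt0r_neq0 y20)); rewrite cE2 /nu; field.
    exact: y0.
  have munu : mu * nu = 1.
    have -> : mu * nu = (y ^+ 2 * (t 0 0 * t 1 1) - t 0 1 *
        (x * (t 0 1 * x + t 1 1 * y - t 0 0 * y))) / y ^+ 2.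
      by rewrite /mu /nu; field.
    by rewrite -cE2 (det_eq1 dt); field.
  exists (mu ^+ 2); rewrite s0E.
  have -> : t *m mx2 x y z (- x) = mu *: mx2 x y z (- x).
    by apply: mx2_eq; rewrite !mx2E ?cE ?zE /mu /nu; field.
  have -> : mx2 x y z (- x) *m t = nu *: mx2 x y z (- x).
    by apply: mx2_eq; rewrite !mx2E ?cE ?zE /nu; field.
  by rewrite scalerA expr2 -mulrA munu mulr1.
have n10 : n1 = 0 by apply: (mulfI y0); rewrite n12 n20 !mulr0.
have n30 : n3 = 0.
  apply: (mulfI y0); have -> : y * n3 = - (2 * x * n1 + z * n2).
    by rewrite /n1 /n2 /n3; ring.
  by rewrite n10 n20 !mulr0 addr0 oppr0.
exists 1; rewrite scale1r s0E; move: n10 n20 n30; rewrite /n1 /n2 /n3 => h1 h2 h3.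
by apply: mx2_eq; rewrite !mx2E; lra.
Qed.
End TracelessPart.

(** * Short hyperbolic words *)

Section HyperbolicWords.
Variable R : realType.

Lemma SA_realM (g h : SA int) : SA_real R (g * h)%g = (SA_real R g * SA_real R h)%g.
Proof.
by apply: SA_eq; rewrite /theta /tau /= ?map_mxM// map_mxD map_mxM.
Qed.

Lemma SA_real_inj : injective (SA_real R).
Proof.
have inj m n : injective (@map_mx _ _ (intr : int -> R) m n).
  move=> A B /matrixP AB; apply/matrixP => i j; have := AB i j.
  by rewrite !mxE => /intr_inj.
move=> g h gh; apply: SA_eq.
- by apply: inj; have := congr1 (@theta R) gh.
- by apply: inj; have := congr1 (@tau R) gh.
Qed.

(** No square lies strictly between [(T - 1)^2] and [T^2] and [T^2 - 4] does, so the
discriminant of a hyperbolic integer matrix is not a square. *)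
Lemma hyperbolic_discriminant_nonsquare (m n T : int) :
  3 <= T -> m ^+ 2 = (T ^+ 2 - 4) * n ^+ 2 -> n = 0.
Proof.
move=> T3 mn; apply/eqP/negPn/negP => n0.
have /dvdzP[k mk] : (n %| m)%Z.
  by rewrite -(@dvdz_pexp2r n m 2)//; apply/dvdzP; exists (T ^+ 2 - 4).
have n20 : n ^+ 2 != 0 by rewrite sqrf_eq0.
have kT : k ^+ 2 = T ^+ 2 - 4 by apply: (mulIf n20); rewrite -mn mk exprMn.
pose j := `|k|; have j0 : 0 <= j by exact: normr_ge0.
have jT : j ^+ 2 = T ^+ 2 - 4 by rewrite -kT /j real_normK// num_real.
have jltT : j < T by nia.
have : j <= T - 1 by lia.
nia.
Qed.

(** [A'] is twice the traceless part of [A]. Both hypotheses say that an integral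
quadratic form in two variables of the shape [m^2 - (tr A ^ 2 - 4) n^2] vanishes,
hence that [m = n = 0]; so two conjugate hyperbolic integer matrices
that share one fixed point on the projective line share both. *)
Lemma transverse_int (A B : 'M[int]_2) : \det A = 1 -> \det B = 1 -> 3 <= \tr A ->
  let A' := A *+ 2 - (\tr A)%:M in
  [/\ \tr (A *m B *m \adj A *m \adj B) = 2 -> B *m A' = A' *m B &
      \tr (A *m B *m A *m \adj B) = 2 -> B *m A' = - (A' *m B)].
Proof.
move=> dA dB T3 A'; have [eA eB] := (det_eq1 dA, det_eq1 dB).
have A'E : A' = mx2 (A 0 0 - A 1 1) (2 * A 0 1) (2 * A 1 0) (A 1 1 - A 0 0).
  by apply: mx2_eq; rewrite /A' mulr2n !mx2E; ring.
rewrite A'E trace_commutator//; split=> [E0|E0].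
- pose d := A 0 0 - A 1 1.
  pose n1 := A 0 1 * B 1 0 - B 0 1 * A 1 0.
  pose n2 := d * B 0 1 + A 0 1 * (B 1 1 - B 0 0).
  pose n3 := A 1 0 * (B 0 0 - B 1 1) - d * B 1 0.
  have {}E0 : n1 ^+ 2 + n2 * n3 = 0.
    have -> : n1 ^+ 2 + n2 * n3 = 2 - \det (A *m B - B *m A) - 2.
      by rewrite !mx2E /n1 /n2 /n3 /d; ring.
    by rewrite E0 subrr.
  have key : (2 * A 0 1 * n1 - d * n2) ^+ 2 = ((\tr A) ^+ 2 - 4) * n2 ^+ 2.
    have -> : (2 * A 0 1 * n1 - d * n2) ^+ 2 =
      4 * A 0 1 ^+ 2 * (n1 ^+ 2 + n2 * n3) + (d ^+ 2 + 4 * (A 0 1 * A 1 0)) * n2 ^+ 2.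
      by rewrite /n1 /n2 /n3 /d; ring.
    by rewrite E0 mulr0 add0r !mx2E /d; congr (_ * _); move: eA; lra.
  have n20 := hyperbolic_discriminant_nonsquare T3 key.
  have q0 : A 0 1 != 0.
    apply/eqP => q0; have : d ^+ 2 = ((\tr A) ^+ 2 - 4) * 1 ^+ 2.
      by move: eA; rewrite q0 !mx2E /d; lra.
    by move/(hyperbolic_discriminant_nonsquare T3).
  have n10 : n1 = 0.
    move: key; rewrite n20 mulr0 subr0 expr0n mulr0 => /eqP.
    by rewrite sqrf_eq0 !mulf_eq0 (negPf q0) /= => /eqP.
  have n30 : n3 = 0.
    apply: (mulfI q0); have -> : A 0 1 * n3 = - (d * n1 + A 1 0 * n2).
      by rewrite /n1 /n2 /n3 /d; ring.
    by rewrite n10 n20 !mulr0 addr0 oppr0.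
  move: n10 n20 n30; rewrite /n1 /n2 /n3 /d => h1 h2 h3.
  by apply: mx2_eq; rewrite !mx2E; lra.
pose w := (A 0 0 - A 1 1) * (B 0 0 - B 1 1) + 2 * A 0 1 * B 1 0 + 2 * A 1 0 * B 0 1.
have key : w ^+ 2 = ((\tr A) ^+ 2 - 4) * (\tr B) ^+ 2.
  have : w ^+ 2 - ((\tr A) ^+ 2 - 4) * (\tr B) ^+ 2 =
    4 * (2 - \tr (A *m B *m A *m \adj B)).
    have : w ^+ 2 - ((\tr A) ^+ 2 - 4 * \det A) * (\tr B) ^+ 2 =
      4 * (2 * \det A * \det B - \tr (A *m B *m A *m \adj B)).
      by rewrite !mx2E /w; ring.
    by rewrite dA dB !mulr1.
  by rewrite E0 subrr mulr0 => /eqP; rewrite subr_eq0 => /eqP.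
have t0 := hyperbolic_discriminant_nonsquare T3 key.
have w0 : w = 0.
  by move: key; rewrite t0 expr0n mulr0 => /eqP; rewrite sqrf_eq0 => /eqP.
have B11 : B 1 1 = - B 0 0 by move: t0; rewrite mx2E => h; lra.
have {}w0 : (A 0 0 - A 1 1) * B 0 0 + A 0 1 * B 1 0 + A 1 0 * B 0 1 = 0.
  by move: w0; rewrite /w B11; lra.
by apply: mx2_eq; rewrite !mx2E ?B11; lra.
Qed.

Variables (gT : groupType) (v : gT -> SA int).
Hypothesis vM : forall x y, v (x * y)%g = (v x * v y)%g.

Definition linear_part (g : gT) : 'M[R]_2 := theta (SA_real R (v g)).
Local Notation rot := linear_part.

Lemma linear_partM g h : rot (g * h)%g = rot g *m rot h.
Proof. by rewrite /linear_part vM SA_realM. Qed.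

Lemma linear_part1 : rot 1%g = 1%:M.
Proof. by rewrite /linear_part (morphism1 vM) /theta /= map_mx1. Qed.

Lemma det_linear_part g : \det (rot g) = 1.
Proof. exact: det_theta. Qed.

Lemma linear_partV g : rot g^-1%g = \adj (rot g).
Proof.
by rewrite /linear_part (morphismV vM); exact: map_mx_adj.
Qed.

Lemma linear_partVK g : rot g *m rot g^-1%g = 1%:M.
Proof. by rewrite linear_partV mul_mx_adj det_linear_part. Qed.

Lemma trace_linear_part g : \tr (rot g) = (\tr (theta (v g)))%:~R.
Proof. by rewrite trace_map_mx. Qed.

Definition moves_line (X : 'M[R]_2) (g : gT) := ~ normalizes_line X (rot g).

Lemma square_hyperbolic g : 3 <= `|\tr (rot g)| -> 7 <= \tr (rot (g * g)%g).
Proof.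
rewrite linear_partM trace_sqr ?det_linear_part// -(real_normK (num_real (\tr _))).
by move: `| _ | => x; nra.
Qed.

Lemma normalizes_scalar (X : 'M[R]_2) k : normalizes_line X k%:M.
Proof. by exists 1; rewrite scale1r scalar_mxC. Qed.

Lemma traceless_neq0 g X : moves_line X g -> traceless (rot g) != 0.
Proof.
move=> mv; apply/eqP => /eqP; rewrite subr_eq0 => /eqP gE; apply: mv.
by rewrite gE; exact: normalizes_scalar.
Qed.

(** If [s] is not hyperbolic, the trace of its commutator with an element that moves
the line of its traceless part is an integer greater than [2]. The squares
are only there to make the trace positive and large. *)
Lemma hyperbolic_word (S : set gT) :
  (forall X : 'M[R]_2, X != 0 -> \tr X = 0 -> exists2 s, S s & moves_line X s) ->
  exists s t, [/\ S s, S t &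
    7 <= \tr (rot (s * s)%g) \/
    let w := (s * t * s^-1 * t^-1)%g in 7 <= \tr (rot (w * w)%g)].
Proof.
move=> mvS; have E0 : mx2 0 1 0 0 != 0 :> 'M[R]_2.
  apply/eqP => /matrixP/(_ 0 1); rewrite !mx2E mxE => /eqP.
  by rewrite oner_eq0.
have [|s Ss /traceless_neq0 s0] := mvS _ E0; first by rewrite !mx2E addr0.
have [t St mv] := mvS _ s0 (tr_traceless _).
exists s, t; split=> //.
have [hyp|nhyp] := leP 3 `|\tr (rot s)|; [left|right].
  exact: square_hyperbolic.
apply: square_hyperbolic; apply: le_trans (ler_norm _).
have trs : \tr (rot s) ^+ 2 <= 4.
  move: nhyp; rewrite trace_linear_part -intr_norm -[3]/(3%:~R) ltr_int => n3.
  rewrite -rmorphXn -[4]/(4%:~R) ler_int.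
  by move: (\tr _) n3 => m; nia.
have [ds dt] := (det_linear_part s, det_linear_part t).
have [le0 ne0] := nonhyperbolic_commutator ds dt s0 trs.
have lt0 : \det (rot s *m rot t - rot t *m rot s) < 0.
  by rewrite lt_neqAle le0 andbT; apply/eqP => /ne0.
have : 2 < \tr (rot (s * t * s^-1 * t^-1)%g).
  by rewrite !linear_partM !linear_partV trace_commutator//; lra.
by rewrite trace_linear_part -[2]/(2%:~R) -[3]/(3%:~R) ltr_int ler_int; lia.
Qed.

(** For [c = g a g^-1], the trace of [a c^-1] is [2] exactly when [a] and [c] share their
attracting or their repelling fixed points, which is excluded by [transverse_int];
likewise for [a c]. *)
Lemma transverse (a g : gT) : 7 <= \tr (rot a) -> moves_line (traceless (rot a)) g ->
  1 <= `|\tr (rot (a * g * a^-1 * g^-1)%g) - 2| /\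
  1 <= `|\tr (rot (a * g * a * g^-1)%g) - 2|.
Proof.
move=> tra mv.
have tra3 : 3 <= \tr (theta (v a)).
  by move: tra; rewrite trace_linear_part -[7]/(7%:~R) ler_int; lia.
have [h1 h2] := transverse_int (det_theta (v a)) (det_theta (v g)) tra3.
have A'E : map_mx intr (theta (v a) *+ 2 - (\tr (theta (v a)))%:M) =
    2 *: traceless (rot a).
  have rotE i j : rot a i j = (theta (v a) i j)%:~R by rewrite mxE.
  apply: mx2_eq; rewrite [LHS]mxE mulr2n !mx2E !rotE ?rmorphD ?rmorphN ?rmorphD ?rmorph0 /=; lra.
have mvk (k : int) : theta (v g) *m (theta (v a) *+ 2 - (\tr (theta (v a)))%:M) =
    k *: ((theta (v a) *+ 2 - (\tr (theta (v a)))%:M) *m theta (v g)) -> False.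
  move=> /(congr1 (map_mx (intr : int -> R))); rewrite map_mxZ !map_mxM A'E.
  rewrite -scalemxAr -scalemxAl scalerA mulrC -scalerA => /(scalerI _) E.
  by apply: mv; exists k%:~R; apply: E; rewrite pnatr_eq0.
have int_gap (h : gT) : \tr (theta (v h)) <> 2 -> 1 <= `|\tr (rot h) - 2|.
  move=> n2; rewrite trace_linear_part -[2]/(2%:~R) -rmorphB -intr_norm -[1]/(1%:~R) ler_int.
  by move: (\tr _) n2 => m n2; lia.
split; apply: int_gap; rewrite !vM !(morphismV vM).
- move=> /h1 E; apply: (mvk 1); rewrite scale1r; exact: E.
- move=> /h2 E; apply: (mvk (-1)); rewrite scaleN1r; exact: E.
Qed.

End HyperbolicWords.

(** * Eigencoordinates and the cross ratio *)

Lemma hyperbolic_lower_left (A : 'M[int]_2) : \det A = 1 -> 3 <= \tr A -> A 1 0 != 0.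
Proof.
move=> /det_eq1 eA T3; apply/eqP => r0; rewrite r0 mulr0 addr0 in eA.
have : (A 0 0 - A 1 1) ^+ 2 = ((\tr A) ^+ 2 - 4) * 1 ^+ 2.
  by rewrite !mx2E; move: eA; lra.
by move/(hyperbolic_discriminant_nonsquare T3).
Qed.

Section Diagonalization.
Variables (R : realType) (gT : groupType) (v : gT -> SA int).
Hypothesis vM : forall x y, v (x * y)%g = (v x * v y)%g.
Local Notation rot := (linear_part R v).

Lemma diagonalize (a : gT) : 7 <= \tr (rot a) ->
  exists l P, [/\ 6 <= l, P \in unitmx & P *m rot a = mx2 l 0 0 l^-1 *m P].
Proof.
move=> tra; set T := \tr (rot a) in tra; pose s := Num.sqrt (T ^+ 2 - 4).
have s2 : s ^+ 2 = T ^+ 2 - 4 by rewrite sqr_sqrtr//; nra.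
have s0 : 0 <= s by exact: sqrtr_ge0.
have s6 : 6 <= s by nra.
pose l := (T + s) / 2; have l6 : 6 <= l by rewrite /l; lra.
have l0 : l != 0 by rewrite gt_eqF// (lt_le_trans _ l6).
have lT : l ^+ 2 = l * T - 1 by rewrite /l; lra.
have lV : l^-1 = T - l by apply: (mulfI l0); rewrite divff// mulrBr -expr2 lT opprB addrC subrK.
have r0 : rot a 1 0 != 0.
  rewrite mxE intr_eq0; apply: hyperbolic_lower_left; first exact: det_theta.
  by move: tra; rewrite /T trace_linear_part -[7]/(7%:~R) ler_int; apply: le_trans.
have eA := det_eq1 (det_linear_part R v a).
have TE : T = rot a 0 0 + rot a 1 1 by rewrite /T mx2E.
exists l, (mx2 (rot a 1 0) (l - rot a 0 0) (rot a 1 0) (l^-1 - rot a 0 0)); split=> //.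
  rewrite unitmxE unitfE !mx2E.
  rewrite [X in X != 0](_ : _ = rot a 1 0 * (l^-1 - l)); last by ring.
  by rewrite mulf_neq0// subr_eq0 lV; apply/eqP; move: l6; rewrite /l; lra.
move: lT lV eA; rewrite TE; move: (l^-1) (l) => k m lT -> eA.
by apply: mx2_eq; rewrite !mx2E; lra.
Qed.

(** [M] is the change of coordinates from the eigenframe of [a] to that of the
conjugate of [a] by [g], so the traces can be computed with diagonal matrices. *)
Lemma eigen_change (a g : gT) l (P : 'M[R]_2) : l != 0 -> P \in unitmx ->
  P *m rot a = mx2 l 0 0 l^-1 *m P ->
  let M := P *m rot g^-1%g *m invmx P in
  [/\ \det M = 1,
      \tr (rot (a * g * a^-1 * g^-1)%g) - 2 = - (M 0 1 * M 1 0 * (l - l^-1) ^+ 2) &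
      \tr (rot (a * g * a * g^-1)%g) - 2 = M 0 0 * M 1 1 * (l - l^-1) ^+ 2].
Proof.
move=> l0 Pu Pa M; set L := mx2 l 0 0 l^-1 in Pa.
have PV : invmx P *m P = 1%:M by exact: mulVmx.
have VP : P *m invmx P = 1%:M by exact: mulmxV.
have conjM (X Y : 'M[R]_2) : (P *m X *m invmx P) *m (P *m Y *m invmx P) = P *m (X *m Y) *m invmx P.
  by rewrite !mulmxA -(mulmxA (P *m X)) PV mulmx1.
have dconj (X : 'M[R]_2) : \det (P *m X *m invmx P) = \det X.
  by rewrite !det_mulmx mulrAC -det_mulmx VP det1 mul1r.
have dM : \det M = 1 by rewrite dconj det_linear_part.
have aE : P *m rot a *m invmx P = L by rewrite Pa -mulmxA VP mulmx1.
have adjE (h : gT) : P *m rot h^-1%g *m invmx P = \adj (P *m rot h *m invmx P).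
  have d1 : \det (P *m rot h *m invmx P) = 1 by rewrite dconj det_linear_part.
  rewrite -[LHS]mul1mx.
  rewrite -[X in X *m _](_ : \adj (P *m rot h *m invmx P) *m (P *m rot h *m invmx P) = _);
    last by rewrite mul_adj_mx d1.
  rewrite -(mulmxA (\adj _)) conjM linear_partV; last exact: vM.
  by rewrite mul_mx_adj det_linear_part mulmx1 VP mulmx1.
have gE : P *m rot g *m invmx P = \adj M.
  by rewrite -[in LHS](invgK g) adjE.
have trE (X : 'M[R]_2) : \tr X = \tr (P *m X *m invmx P).
  by rewrite mxtrace_mulC mulmxA PV mul1mx.
have eM := det_eq1 dM; have lV : l * l^-1 = 1 by rewrite divff.
split=> //; rewrite trE !linear_partM// -!conjM aE gE -/M.
- rewrite (adjE a) aE /L; clearbody M; rewrite !mx2E; move: (l^-1) lV => k lk.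
  rewrite [LHS](_ : _ = 2 * (l * k) * (M 0 0 * M 1 1 - M 0 1 * M 1 0) - 2 -
    M 0 1 * M 1 0 * (l - k) ^+ 2); last by ring.
  by rewrite lk eM; ring.
- rewrite /L; clearbody M; rewrite !mx2E; move: (l^-1) lV => k lk.
  rewrite [LHS](_ : _ = 2 * (l * k) * (M 0 0 * M 1 1 - M 0 1 * M 1 0) - 2 +
    M 0 0 * M 1 1 * (l - k) ^+ 2); last by ring.
  by rewrite lk eM; ring.
Qed.

(** The hypotheses [1 <= _] express that two nonzero numbers are integers. They keep
[al de] and [be ga] away from [0] on the scale of [l], hence the cross ratio,
as these two numbers differ by [1]. *)
Lemma cross_ratio_bounds (l al be ga de : R) : 6 <= l -> al * de = 1 + be * ga ->
  1 <= `|be * ga * (l - l^-1) ^+ 2| -> 1 <= `|al * de * (l - l^-1) ^+ 2| ->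
  [/\ be * ga != 0, al * de != 0,
     `|al * de / (be * ga)| <= l ^+ 3 & 1 <= l ^+ 3 * `|al * de / (be * ga)|].
Proof.
move=> l6 dM h1 h2.
have l0 : 0 < l by apply: lt_le_trans l6.
have D0 : 0 <= (l - l^-1) ^+ 2 by exact: sqr_ge0.
have lV0 : 0 < l^-1 by rewrite invr_gt0.
have Dl : (l - l^-1) ^+ 2 <= l ^+ 2.
  have l1 : l^-1 <= 1 by rewrite invf_le1//; lra.
  by rewrite ler_sqr ?nnegrE ?(ltW l0)//; lra.
have {}h1 : 1 <= l ^+ 2 * `|be * ga|.
  by apply: le_trans h1 _; rewrite normrM (ger0_norm D0) mulrC ler_wpM2r.
have {}h2 : 1 <= l ^+ 2 * `|al * de|.
  by apply: le_trans h2 _; rewrite normrM (ger0_norm D0) mulrC ler_wpM2r.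
have b0 : 0 < `|be * ga|.
  by rewrite lt_def normr_ge0 andbT; apply: contraTneq h1 => ->; rewrite mulr0; lra.
have a0 : 0 < `|al * de|.
  by rewrite lt_def normr_ge0 andbT; apply: contraTneq h2 => ->; rewrite mulr0; lra.
have aux x : 0 < x -> 1 <= l ^+ 2 * x -> 1 + x <= l ^+ 3 * x.
  move=> x0 x1; have x2 : x <= l ^+ 2 * x.
    by rewrite ler_peMl ?(ltW x0)// exprn_ege1//; lra.
  rewrite (exprS _ 2) -mulrA; apply: (@le_trans _ _ (6 * (l ^+ 2 * x))); first by lra.
  by rewrite ler_wpM2r//; lra.
split; rewrite -?normr_gt0 ?normf_div ?ler_pdivrMr// ?mulrA ?ler_pdivlMr ?mul1r//.
- apply: (@le_trans _ _ (1 + `|be * ga|)); first by rewrite dM (le_trans (ler_normD _ _))// normr1.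
  exact: aux.
- have -> : be * ga = al * de - 1 by rewrite dM; ring.
  apply: (@le_trans _ _ (1 + `|al * de|)); first by rewrite (le_trans (ler_normB _ _))// normr1 addrC.
  exact: aux.
Qed.
End Diagonalization.

(** * The gap for the two types of coset spaces *)

Section Gap.
Variables (R : realType) (gT : groupType) (H : subgroup gT).
Variable f : l2 R (quot H).
Hypothesis f1 : `|f| = 1.
Implicit Types (q : quot H -> R) (g : gT) (L r : R).

(** The bound is the largest one for which the estimate of [annulus_cut], that uses
nine translates by the ninth power of [g], exceeds [1/3] by at most [1/10]. *)
Definition barely_moves g : Prop := 9 * (9 * displacement f g) <= 10^-1.

(** The ninth power provides room for shells whose ratio is a fixed power of the
multiplier of [g]. *)
Lemma annulus_cut q g L r r' : 0 < r -> 1 <= L -> r' < L ^+ 9 * r ->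
  barely_moves g ->
  (forall C, q (quot_act g C) = L * q C) ->
  `|cut [set C | r <= q C <= r'] f| <= 3^-1 + 10^-1.
Proof.
move=> r0 L1 r'L dg qg.
have qg9 C : q (quot_act (g ^+ 9)%g C) = L ^+ 9 * q C by exact: dilationX.
apply: le_trans (dilation_cut f1 r0 (exprn_ege1 9 L1) r'L qg9) _.
rewrite lerD2l; apply: le_trans dg; rewrite ler_wpM2l//.
exact: displacementX.
Qed.

Lemma annulus_cut_pow q g (l b : R) k m n : 6 <= l -> 0 < b -> (m + n < k * 9)%N ->
  barely_moves g ->
  (forall C, q (quot_act g C) = l ^+ k * q C) ->
  `|cut [set C | (l ^+ n)^-1 * b <= q C <= l ^+ m * b] f| <= 3^-1 + 10^-1.
Proof.
move=> l6 b0 mnk; have l0 : 0 < l by apply: lt_le_trans l6.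
have l1 : 1 < l by lra.
apply: annulus_cut; rewrite ?mulr_gt0 ?invr_gt0 ?exprn_gt0 ?exprn_ege1 ?(ltW l1)//.
rewrite mulrA ltr_pM2r// ltr_pdivlMr ?exprn_gt0//.
by rewrite -exprD -exprM ltr_eXn2l.
Qed.

(** The squared norm of [f] on each set is less than [1/5]. *)
Lemma no_cover (W1 W2 W3 W4 W5 : set (quot H)) :
  `|cut W1 f| <= 3^-1 + 10^-1 -> `|cut W2 f| <= 3^-1 + 10^-1 ->
  `|cut W3 f| <= 3^-1 + 10^-1 -> `|cut W4 f| <= 3^-1 + 10^-1 ->
  `|cut W5 f| <= 3^-1 + 10^-1 ->
  ~ (forall C, W1 C \/ W2 C \/ W3 C \/ W4 C \/ W5 C).
Proof.
move=> h1 h2 h3 h4 h5 cov.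
pose W (i : 'I_5) := nth set0 [:: W1; W2; W3; W4; W5] i.
have covW C : exists i, W i C.
  have [h|[h|[h|[h|h]]]] := cov C.
  - by exists (inord 0); rewrite /W inordK.
  - by exists (inord 1); rewrite /W inordK.
  - by exists (inord 2); rewrite /W inordK.
  - by exists (inord 3); rewrite /W inordK.
  - by exists (inord 4); rewrite /W inordK.
have := norm_le_cover f covW; rewrite f1 expr1n.
have sq (V : set (quot H)) : `|cut V f| <= 3^-1 + 10^-1 -> 5 * `|cut V f| ^+ 2 < 1.
  by have := normr_ge0 (cut V f); move: `|_| => x x0 x1; nra.
rewrite !big_ord_recl big_ord0 /W /= addr0.
by have := (sq _ h1, sq _ h2, sq _ h3, sq _ h4, sq _ h5) => -[[[[]]]]; lra.
Qed.

Lemma norm_scale (t x y : R) : 0 <= t -> y = t * x -> `|y| = t * `|x|.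
Proof. by move=> t0 ->; rewrite normrM ger0_norm. Qed.

Variables (a c : gT) (l al be ga de : R).
Hypotheses (da : barely_moves a) (dc : barely_moves c).
Hypothesis l6 : 6 <= l.

Let l0 : 0 < l. Proof. by apply: lt_le_trans l6. Qed.
Let lN0 : l != 0. Proof. by rewrite gt_eqF. Qed.

(** [u], [v] are eigencoordinates for [a], and [hp], [hm] for [c]; the shells of
[plane_cover] for them all wander. The last hypothesis says that [e1] is the larger
of the two coordinates of the centre of [a], once rescaled as in [plane_cover]. *)
Lemma plane_gap (u v hp hm : quot H -> R) e1 e2 :
  be * ga != 0 -> al * de != 0 ->
  `|al * de / (be * ga)| <= l ^+ 3 -> 1 <= l ^+ 3 * `|al * de / (be * ga)| ->
  (forall C, u (quot_act a C) = l * u C) -> (forall C, v (quot_act a C) = l^-1 * v C) ->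
  (forall C, hp (quot_act c C) = l * hp C) -> (forall C, hm (quot_act c C) = l^-1 * hm C) ->
  (forall C, hp C = al * u C + be * v C - e1) ->
  (forall C, hm C = ga * u C + de * v C - e2) ->
  e1 != 0 -> `|e2 * al| <= `|e1 * ga| -> False.
Proof.
move=> bg0 ad0 k1 k2 ua va hpc hmc hpE hmE e10 dom.
move: bg0 ad0; rewrite !mulf_eq0 !negb_or => /andP[be0 ga0] /andP[al0 de0].
set k := al * de / (be * ga) in k1 k2.
pose e' := al * e2 / ga.
have e'1 : `|e'| <= `|e1|.
  by rewrite /e' normf_div ler_pdivrMr ?normr_gt0// (mulrC al) -(normrM e1).
have p1 : 0 < `|e1| by rewrite normr_gt0.
have daV : barely_moves a^-1%g by rewrite /barely_moves displacementV; exact: da.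
pose U C := al * u C; pose V C := be * v C.
have UE C : U (quot_act a C) = l * U C by rewrite /U ua mulrCA.
have VE C : V (quot_act a C) = l^-1 * V C by rewrite /V va mulrCA.
have VVE C : V (quot_act a^-1%g C) = l * V C.
  have := VE (quot_act a^-1%g C); rewrite quot_actM mulgV quot_act1 => ->.
  by rewrite mulrA divff// mul1r.
have hmE' C : U C + k * V C - e' = al / ga * hm C.
  by rewrite hmE /U /V /k /e'; field; rewrite ga0.
apply: (@no_cover [set C | (l ^+ 4)^-1 * 1 <= `|U C / V C| <= l ^+ 4 * 1]
  [set C | (l ^+ 1)^-1 * `|e1| <= `|U C| <= l ^+ 1 * `|e1|]
  [set C | (l ^+ 1)^-1 * `|e1| <= `|V C| <= l ^+ 4 * `|e1|]
  [set C | (l ^+ 1)^-1 * `|e1| <= `|hp C| <= l ^+ 1 * `|e1|]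
  [set C | (l ^+ 4)^-1 * 1 <= `|hp C / (al / ga * hm C)| <= l ^+ 4 * 1]).
- apply: (annulus_cut_pow (g := a) (k := 2) (m := 4) (n := 4) l6 ltr01 isT da) => C.
  by apply: norm_scale; rewrite ?exprn_ge0 ?(ltW l0)// UE VE invfM invrK; ring.
- apply: (annulus_cut_pow (g := a) (k := 1) (m := 1) (n := 1) l6 p1 isT da) => C.
  by rewrite UE normrM (gtr0_norm l0) expr1.
- apply: (annulus_cut_pow (g := a^-1%g) (k := 1) (m := 4) (n := 1) l6 p1 isT daV) => C.
  by rewrite VVE normrM (gtr0_norm l0) expr1.
- apply: (annulus_cut_pow (g := c) (k := 1) (m := 1) (n := 1) l6 p1 isT dc) => C.
  by rewrite hpc normrM (gtr0_norm l0) expr1.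
- apply: (annulus_cut_pow (g := c) (k := 2) (m := 4) (n := 4) l6 ltr01 isT dc) => C.
  apply: norm_scale; rewrite ?exprn_ge0 ?(ltW l0)// hpc hmc invfM [X in _ = _ * (_ * X)]invfM.
  by rewrite (invfM l^-1) invrK; move: (al / ga)^-1 (hm C)^-1 => t w; ring.
move=> C; rewrite /= !mulr1 !expr1 -hmE'.
have -> : hp C = U C + V C - e1 by rewrite hpE.
have [->|[->|[->|[|->]]]] := plane_cover l6 k1 k2 (U C) (V C) e10 e'1; auto 6.
move=> /andP[h1 h2]; do 3!right; left; apply/andP; split.
- by apply: le_trans h1; rewrite ler_pM2r// lef_pV2 ?posrE//; have := l6; lra.
- by apply: le_trans h2 _; rewrite ler_pM2r//; have := l6; lra.
Qed.

(** [x], [y], [z] are the coordinates, on the eigenlines of [a], of an element of sl2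
known up to a scalar, whence the factors [k]; only their quotients are used. *)
Lemma sl2_gap (x y z y' z' : quot H -> R) :
  be * ga != 0 -> al * de != 0 ->
  `|al * de / (be * ga)| <= l ^+ 3 -> 1 <= l ^+ 3 * `|al * de / (be * ga)| ->
  (forall C, exists2 k, k != 0 & [/\ x (quot_act a C) = k * x C,
     y (quot_act a C) = k * (l ^+ 2 * y C) & z (quot_act a C) = k * (l ^- 2 * z C)]) ->
  (forall C, exists2 k, k != 0 & y' (quot_act c C) = k * (l ^+ 2 * y' C) /\
     z' (quot_act c C) = k * (l ^- 2 * z' C)) ->
  (forall C, y' C = al ^+ 2 * y C - 2 * al * be * x C - be ^+ 2 * z C) ->
  (forall C, z' C = - (ga ^+ 2 * y C - 2 * ga * de * x C - de ^+ 2 * z C)) ->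
  (forall C, [|| x C != 0, y C != 0 | z C != 0]) -> False.
Proof.
move=> bg0 ad0 k1 k2 xyza yzc y'E z'E nz.
move: bg0 ad0; rewrite !mulf_eq0 !negb_or => /andP[be0 ga0] /andP[al0 de0].
set k := al * de / (be * ga) in k1 k2.
pose Y C := al ^+ 2 * y C; pose X C := al * be * x C; pose Z C := be ^+ 2 * z C.
have nZ C : [|| X C != 0, Y C != 0 | Z C != 0].
  by rewrite /X /Y /Z !mulf_eq0 (negPf al0) (negPf be0) /=; exact: nz.
have y'E' C : y' C = Y C - 2 * X C - Z C by rewrite y'E /X /Y /Z; ring.
have z'E' C : Y C - 2 * k * X C - k ^+ 2 * Z C = - (al / ga) ^+ 2 * z' C.
  by rewrite z'E /X /Y /Z /k; field; rewrite ga0 be0.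
have lk0 : 0 <= l by exact: ltW.
have W1 : `|cut [set C | (l ^+ 7)^-1 * 1 <= `|Y C / Z C| <= l ^+ 7 * 1] f| <= 3^-1 + 10^-1.
  apply: (annulus_cut_pow (g := a) (k := 4) (m := 7) (n := 7) l6 ltr01 isT da) => C.
  have [m m0 [xE yE zE]] := xyza C; rewrite /Y /Z yE zE.
  apply: norm_scale; rewrite ?exprn_ge0 ?(ltW l0)// !invfM invrK.
  by move: (z C)^-1 => w; field; rewrite ?m0 ?lN0 ?be0 ?al0 ?ga0 ?oppr_eq0 ?invr_eq0.
apply: (@no_cover [set C | (l ^+ 7)^-1 * 1 <= `|Y C / Z C| <= l ^+ 7 * 1]
  [set C | (l ^+ 7)^-1 * 1 <= `|Y C / Z C| <= l ^+ 7 * 1]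
  [set C | (l ^+ 4)^-1 * 1 <= `|Y C / X C| <= l ^+ 4 * 1]
  [set C | (l ^+ 4)^-1 * 1 <= `|X C / Z C| <= l ^+ 4 * 1]
  [set C | (l ^+ 7)^-1 * 1 <= `|y' C / (- (al / ga) ^+ 2 * z' C)| <= l ^+ 7 * 1]) => //.
- apply: (annulus_cut_pow (g := a) (k := 2) (m := 4) (n := 4) l6 ltr01 isT da) => C.
  have [m m0 [xE yE zE]] := xyza C; rewrite /Y /X yE xE.
  apply: norm_scale; rewrite ?exprn_ge0 ?(ltW l0)// !invfM.
  by move: (x C)^-1 => w; field; rewrite ?m0 ?lN0 ?be0 ?al0 ?ga0 ?oppr_eq0 ?invr_eq0.
- apply: (annulus_cut_pow (g := a) (k := 2) (m := 4) (n := 4) l6 ltr01 isT da) => C.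
  have [m m0 [xE yE zE]] := xyza C; rewrite /X /Z xE zE.
  apply: norm_scale; rewrite ?exprn_ge0 ?(ltW l0)// !invfM invrK.
  by move: (z C)^-1 => w; field; rewrite ?m0 ?lN0 ?be0 ?al0 ?ga0 ?oppr_eq0 ?invr_eq0.
- apply: (annulus_cut_pow (g := c) (k := 4) (m := 7) (n := 7) l6 ltr01 isT dc) => C.
  have [m m0 [yE zE]] := yzc C; rewrite yE zE.
  apply: norm_scale; rewrite ?exprn_ge0 ?(ltW l0)// !invfM invrK.
  by move: (z' C)^-1 (- (al / ga) ^+ 2)^-1 => w t; field; rewrite ?m0 ?lN0 ?be0 ?al0 ?ga0 ?oppr_eq0 ?invr_eq0.
move=> C; rewrite /= !mulr1 -z'E' y'E'.
by have [->|[->|[->|->]]] := sl2_cover l6 k1 k2 (nZ C); auto 6.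
Qed.
End Gap.

Section CosetRepresentatives.
Variables (gT : groupType) (H : subgroup gT).

Lemma coset_repP (C : quot H) : exists x, left_coset x H = val C.
Proof. by have := valP C; rewrite inE => -[x _ <-]; exists x. Qed.

Definition coset_rep (C : quot H) : gT := projT1 (cid (coset_repP C)).

Lemma left_coset_rep C : left_coset (coset_rep C) H = val C.
Proof. by rewrite /coset_rep; case: cid. Qed.

Lemma coset_rep_act g C :
  exists2 h, carrier H h & coset_rep (quot_act g C) = (g * coset_rep C * h)%g.
Proof.
have : left_coset (coset_rep (quot_act g C)) H (coset_rep (quot_act g C)).
  by exists 1%g; [exact: subgroup1|rewrite mulg1].
rewrite left_coset_rep /= -left_coset_rep left_cosetM => -[h Hh <-].
by exists h.
Qed.
End CosetRepresentatives.

Section GapForActions.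
Variables (R : realType) (gT : groupType) (v : gT -> SA int).
Hypothesis vM : forall x y, v (x * y)%g = (v x * v y)%g.
Local Notation rot := (linear_part R v).

Definition action (g : gT) (x : 'cV[R]_2) := affine (SA_real R (v g)) x.

Lemma actionM g h x : action (g * h)%g x = action g (action h x).
Proof. by rewrite /action vM SA_realM affineM. Qed.

Lemma action1 x : action 1%g x = x.
Proof.
have v1 := morphism1 vM.
rewrite /action v1 /affine /theta /tau /= map_mx1 map_mx0.
by rewrite mul1mx addr0.
Qed.

Lemma actionK g x : action g^-1%g (action g x) = x.
Proof. by rewrite -actionM mulVg action1. Qed.

Lemma actionB g x y : action g x - action g y = rot g *m (x - y).
Proof. by rewrite /action /affine opprD addrACA subrr addr0 mulmxBr. Qed.

Lemma hyperbolic_fixed_point a : 7 <= \tr (rot a) -> exists p, action a p = p.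
Proof.
move=> tra; pose B := rot a - 1%:M.
have Bu : B \in unitmx.
  rewrite unitmxE unitfE det_sub1 ?det_linear_part// subr_eq0.
  by apply/eqP => E; move: tra; rewrite -E; lra.
exists (- (invmx B *m tau (SA_real R (v a)))); set p := - _.
have Bp : B *m p = - tau (SA_real R (v a)) by rewrite mulmxN mulmxA mulmxV// mul1mx.
rewrite /action /affine -[theta _]/(rot a).
have -> : rot a = B + 1%:M by rewrite subrK.
by rewrite mulmxDl mul1mx Bp addrAC addNr add0r.
Qed.

Variables (H : subgroup gT) (f : l2 R (quot H)) (a g : gT).
Hypothesis f1 : `|f| = 1.
Hypothesis da : barely_moves f a.
Hypothesis dc : barely_moves f (g * a * g^-1)%g.
Hypothesis tra : 7 <= \tr (rot a).
Hypothesis mv : moves_line v (traceless (rot a)) g.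

(** The frame in which the coverings are used: [M] compares the eigencoordinates of
[a] with those of [g a g^-1]. *)
Lemma eigenframe : exists l (P : 'M[R]_2), let M := P *m rot g^-1%g *m invmx P in
  [/\ 6 <= l, P \in unitmx, P *m rot a = mx2 l 0 0 l^-1 *m P, \det M = 1 &
  [/\ M 0 1 * M 1 0 != 0, M 0 0 * M 1 1 != 0,
     `|M 0 0 * M 1 1 / (M 0 1 * M 1 0)| <= l ^+ 3 &
     1 <= l ^+ 3 * `|M 0 0 * M 1 1 / (M 0 1 * M 1 0)| ]].
Proof.
have [l [P [l6 Pu Pa]]] := diagonalize tra.
have l0 : l != 0 by rewrite gt_eqF// (lt_le_trans _ l6).
have [dM h1 h2] := eigen_change vM g l0 Pu Pa.
have [t1 t2] := transverse vM tra mv.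
exists l, P => /=; split=> //; apply: cross_ratio_bounds => //.
- exact: det_eq1.
- by rewrite -normrN -h1.
- by rewrite -h2.
Qed.

(** The coset space maps to the orbit of [p0] in the plane, by an equivariant map. *)
Lemma fixed_point_gap (p0 p : 'cV[R]_2) :
  (forall h, carrier H h -> action h p0 = p0) ->
  action a p = p -> action g p <> p -> False.
Proof.
move=> Hp0 ap gp.
have [l [P /= [l6 Pu Pa dM]]] := eigenframe.
set M := P *m _ *m _ in dM *; move=> [bg0 ad0 k1 k2].
have PV : invmx P *m P = 1%:M by exact: mulVmx.
pose w (x : 'cV[R]_2) := P *m (x - p).
pose Phi (C : quot H) := action (coset_rep C) p0.
have PhiE h C : Phi (quot_act h C) = action h (Phi C).
  rewrite /Phi; have [k Hk ->] := coset_rep_act h C.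
  by rewrite !actionM Hp0.
have wa x : w (action a x) = mx2 l 0 0 l^-1 *m w x.
  by rewrite /w -{1}ap actionB mulmxA Pa mulmxA.
have wg x : w (action g^-1%g x) = M *m w x + w (action g^-1%g p).
  rewrite /w /M -(subrKA (action g^-1%g p)) mulmxDr actionB; congr (_ + _).
  by rewrite -!mulmxA (mulmxA (invmx P)) PV mul1mx.
set e := - w (action g^-1%g p).
have e0 : (e 0 0 != 0) || (e 1 0 != 0).
  rewrite -negb_and; apply/negP => /andP[/eqP e00 /eqP e10]; apply: gp.
  have : e = 0 by apply: cV2_eq; rewrite ?e00 ?e10 [RHS]mxE.
  move=> /eqP; rewrite oppr_eq0 => /eqP /(congr1 (mulmx (invmx P))).
  rewrite mulmxA PV mul1mx mulmx0 => /eqP; rewrite subr_eq0 => /eqP E.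
  by rewrite -{1}E -actionM mulgV action1.
pose c := (g * a * g^-1)%g.
have dcV : barely_moves f c^-1%g by rewrite /barely_moves displacementV; exact: dc.
pose W C := w (Phi C); pose W' C := w (action g^-1%g (Phi C)).
have Wa C : W (quot_act a C) = mx2 l 0 0 l^-1 *m W C by rewrite /W PhiE wa.
have W'c C : W' (quot_act c C) = mx2 l 0 0 l^-1 *m W' C.
  by rewrite /W' PhiE /c -actionM !mulgA mulVg mul1g actionM wa.
have W'E C : W' C = M *m W C - e by rewrite /W' wg opprK.
have l0 : l != 0 by rewrite gt_eqF// (lt_le_trans _ l6).
have W'cV C : W' (quot_act c^-1%g C) = mx2 l^-1 0 0 l *m W' C.
  rewrite -[C in RHS](quot_act1) -(mulgV c) -quot_actM W'c.
  by rewrite mulmxA; rewrite -[LHS]mul1mx; congr (_ *m _);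
    apply: mx2_eq; rewrite !mx2E ?mulr0 ?mul0r ?addr0 ?add0r ?mulVf ?mulfV.
(* exchanging the two coordinates, and c with its inverse, one may assume that the
   first coordinate of the centre of a, seen from c, dominates *)
have [dom|dom] := leP `|e 1 0 * M 0 0| `|e 0 0 * M 1 0|.
- apply: (@plane_gap R _ H f f1 a c l (M 0 0) (M 0 1) (M 1 0) (M 1 1) da dc l6
    (fun C => W C 0 0) (fun C => W C 1 0) (fun C => W' C 0 0) (fun C => W' C 1 0)
    (e 0 0) (e 1 0)) => //.
  + by move=> C; rewrite Wa !mx2E; ring.
  + by move=> C; rewrite Wa !mx2E; ring.
  + by move=> C; rewrite W'c !mx2E; ring.
  + by move=> C; rewrite W'c !mx2E; ring.
  + by move=> C; rewrite W'E !mx2E.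
  + by move=> C; rewrite W'E !mx2E.
  + apply: contraTneq e0 => e00; rewrite e00 eqxx /= negbK.
    move: dom; rewrite e00 mul0r normr0 normr_le0 mulf_eq0 => /orP[//|M0].
    by move: ad0; rewrite mulf_eq0 M0.
apply: (@plane_gap R _ H f f1 a c^-1%g l (M 1 0) (M 1 1) (M 0 0) (M 0 1) da dcV l6
    (fun C => W C 0 0) (fun C => W C 1 0) (fun C => W' C 1 0) (fun C => W' C 0 0)
    (e 1 0) (e 0 0)); rewrite //.
- by rewrite mulrC.
- by rewrite mulrC.
- rewrite -invf_div (mulrC (M 1 1)) (mulrC (M 1 0)) normfV.
  rewrite -(ler_pM2r (x := `|M 0 0 * M 1 1 / (M 0 1 * M 1 0)|)) ?mulVf//.
    by rewrite gt_eqF// normr_gt0 mulf_neq0 ?invr_eq0.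
  by rewrite normr_gt0 mulf_neq0 ?invr_eq0.
- rewrite -invf_div (mulrC (M 1 1)) (mulrC (M 1 0)) normfV ler_pdivlMr ?mul1r//.
  by rewrite normr_gt0 mulf_neq0 ?invr_eq0.
- by move=> C; rewrite Wa !mx2E; ring.
- by move=> C; rewrite Wa !mx2E; ring.
- by move=> C; rewrite W'cV !mx2E; ring.
- by move=> C; rewrite W'cV !mx2E; ring.
- by move=> C; rewrite W'E !mx2E.
- by move=> C; rewrite W'E !mx2E.
- by apply: contraTneq dom => ->; rewrite mul0r normr0 ltNge normr_ge0.
- by apply: ltW.
Qed.

Definition conj_by (h : gT) (Z : 'M[R]_2) := rot h *m Z *m rot h^-1%g.

Lemma conj_byM h k Z : conj_by (h * k)%g Z = conj_by h (conj_by k Z).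
Proof. by rewrite /conj_by invgM !linear_partM// !mulmxA. Qed.

Lemma conj_byZ h k Z : conj_by h (k *: Z) = k *: conj_by h Z.
Proof. by rewrite /conj_by -scalemxAr -scalemxAl. Qed.

Lemma conj_by1 Z : conj_by 1%g Z = Z.
Proof.
by rewrite /conj_by invg1 (linear_part1 R vM) mul1mx mulmx1.
Qed.

(** The coset space maps to the orbit of the line of [X0] in the projective plane of
sl2; representatives [Xc] of these lines are equivariant up to scalars. *)
Lemma invariant_line_gap (X0 : 'M[R]_2) : X0 != 0 -> \tr X0 = 0 ->
  (forall h, carrier H h -> normalizes_line X0 (rot h)) -> False.
Proof.
move=> X00 trX0 nX0.
have [l [P /= [l6 Pu Pa dM]]] := eigenframe.
set M := P *m _ *m _ in dM *; move=> [bg0 ad0 k1 k2].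
have l0 : l != 0 by rewrite gt_eqF// (lt_le_trans _ l6).
have PV : invmx P *m P = 1%:M by exact: mulVmx.
have VP : P *m invmx P = 1%:M by exact: mulmxV.
set L := mx2 l 0 0 l^-1 in Pa; pose L' := mx2 l^-1 0 0 l.
have LL' : L *m L' = 1%:M.
  by apply: mx2_eq; rewrite !mx2E ?mulr0 ?mul0r ?addr0 ?add0r ?mulVf ?mulfV.
have aP : rot a^-1%g *m invmx P = invmx P *m L'.
  have L'P : L' *m P *m rot a = P.
    rewrite -mulmxA Pa mulmxA (_ : L' *m L = 1%:M) ?mul1mx//.
    by apply: mx2_eq; rewrite !mx2E ?mulr0 ?mul0r ?addr0 ?add0r ?mulVf ?mulfV.
  rewrite -[LHS]mul1mx -PV -!mulmxA; congr (_ *m _).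
  by rewrite -{1}L'P -!mulmxA (mulmxA (rot a)) (linear_partVK R vM) mul1mx VP mulmx1.
have H_scales h : carrier H h -> exists2 k, k != 0 & conj_by h X0 = k *: X0.
  move=> Hh; have [k hX] := nX0 h Hh; exists k; last first.
    by rewrite /conj_by hX -scalemxAl -mulmxA (linear_partVK R vM) mulmx1.
  apply: contraNneq X00 => k0; rewrite -[X0]conj_by1 -(mulVg h) conj_byM.
  by rewrite /conj_by hX k0 scale0r mul0mx mulmx0 mul0mx.
pose Xc (C : quot H) := conj_by (coset_rep C) X0.
have XcE h C : exists2 k, k != 0 & Xc (quot_act h C) = k *: conj_by h (Xc C).
  have [h' Hh' E] := coset_rep_act h C; have [k k0 kE] := H_scales _ Hh'.
  by exists k => //; rewrite /Xc E !conj_byM kE !conj_byZ.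
have conj_a Z : P *m conj_by a Z *m invmx P = L *m (P *m Z *m invmx P) *m L'.
  by rewrite /conj_by !mulmxA Pa -!mulmxA aP.
have gP : P *m rot g *m invmx P = \adj M.
  rewrite -[LHS]mul1mx -[X in X *m _](_ : \adj M *m M = _); last by rewrite mul_adj_mx dM.
  rewrite -(mulmxA (\adj M)) -[RHS]mulmx1; congr (_ *m _).
  have gg : rot g^-1%g *m rot g = 1%:M by rewrite -{2}(invgK g) (linear_partVK R vM).
  by rewrite /M !mulmxA -(mulmxA _ (invmx P) P) PV mulmx1 -(mulmxA P) gg mulmx1.
pose Y C := P *m Xc C *m invmx P.
pose Y' C := P *m conj_by g^-1%g (Xc C) *m invmx P.
have Ya C : exists2 k, k != 0 & Y (quot_act a C) = k *: (L *m Y C *m L').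
  have [k k0 kE] := XcE a C; exists k => //.
  by rewrite /Y kE -scalemxAr -scalemxAl conj_a.
have Y'c C : exists2 k, k != 0 & Y' (quot_act (g * a * g^-1)%g C) = k *: (L *m Y' C *m L').
  have [k k0 kE] := XcE (g * a * g^-1)%g C; exists k => //.
  by rewrite /Y' kE conj_byZ -scalemxAr -scalemxAl -conj_byM -mulgA mulKg conj_byM conj_a.
have Y'E C : Y' C = M *m Y C *m \adj M.
  rewrite /Y' /Y /M /conj_by invgK -gP !mulmxA.
  by rewrite -(mulmxA _ (invmx P) P) PV mulmx1 -(mulmxA _ (invmx P) P) PV mulmx1.
have trY C : Y C 1 1 = - Y C 0 0.
  apply/eqP; rewrite -addr_eq0 addrC -mxtrace2E /Y mxtrace_mulC mulmxA PV mul1mx.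
  rewrite /Xc /conj_by mxtrace_mulC mulmxA.
  by rewrite -{2}(invgK (coset_rep C)) (linear_partVK R vM) mul1mx trX0.
have Y0 C : [|| Y C 0 0 != 0, Y C 0 1 != 0 | Y C 1 0 != 0].
  apply/negPn/negP; rewrite !negb_or !negbK => /and3P[/eqP y00 /eqP y01 /eqP y10].
  have Y0 : Y C = 0 by apply: mx2_eq; rewrite [RHS]mxE ?trY ?y00 ?oppr0.
  have X0' : Xc C = 0.
    have -> : Xc C = invmx P *m Y C *m P.
      by rewrite /Y !mulmxA PV mul1mx -mulmxA PV mulmx1.
    by rewrite Y0 mulmx0 mul0mx.
  move/eqP: X00; apply; rewrite -[X0]conj_by1 -(mulVg (coset_rep C)) conj_byM.
  by rewrite -/(Xc C) X0' /conj_by mulmx0 mul0mx.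
clearbody Y Y' M.
apply: (@sl2_gap R _ H f f1 a (g * a * g^-1)%g l (M 0 0) (M 0 1) (M 1 0) (M 1 1) da dc l6
    (fun C => Y C 0 0) (fun C => Y C 0 1) (fun C => Y C 1 0)
    (fun C => Y' C 0 1) (fun C => Y' C 1 0) bg0 ad0 k1 k2).
- move=> C; have [k k0 ->] := Ya C; exists k => //; rewrite /L /L' !mx2E.
  by split; field; rewrite ?l0.
- move=> C; have [k k0 ->] := Y'c C; exists k => //; rewrite /L /L' !mx2E.
  by split; field; rewrite ?l0.
- by move=> C; rewrite Y'E !mx2E trY; ring.
- by move=> C; rewrite Y'E !mx2E trY; ring.
- exact: Y0.
Qed.
End GapForActions.

(** * Zariski closures and rational curves *)

Section PolynomialFunctions.
Variables (R : realType) (T : Type) (Q : (T -> R) -> Prop).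
Hypothesis Qconst : forall c, Q (fun=> c).
Hypothesis QD : forall f g, Q f -> Q g -> Q (fun t => f t + g t).
Hypothesis QM : forall f g, Q f -> Q g -> Q (fun t => f t * g t).

(** Composing polynomials with functions stays in any class of functions closed under the ring
operations; this serves both for regular functions and for Laurent polynomials. *)
Lemma meval_closed n (w : T -> 'I_n -> R) : (forall i, Q (fun t => w t i)) ->
  forall p : mpoly.mpoly n R, Q (fun t => mpoly.meval (w t) p).
Proof.
move=> Qw p.
have Qsum (I : Type) (r : seq I) (F : I -> T -> R) :
    (forall i, Q (F i)) -> Q (fun t => \sum_(i <- r) F i t).
  move=> QF; elim: r => [|i r IHr].
    by rewrite (_ : (fun=> _) = fun=> 0)//; apply/funext => t; rewrite big_nil.
  rewrite (_ : (fun t => _) = fun t => F i t + \sum_(j <- r) F j t); first exact: QD.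
  by apply/funext => t; rewrite big_cons.
have Qprod (I : Type) (r : seq I) (F : I -> T -> R) :
    (forall i, Q (F i)) -> Q (fun t => \prod_(i <- r) F i t).
  move=> QF; elim: r => [|i r IHr].
    by rewrite (_ : (fun=> _) = fun=> 1)//; apply/funext => t; rewrite big_nil.
  rewrite (_ : (fun t => _) = fun t => F i t * \prod_(j <- r) F j t); first exact: QM.
  by apply/funext => t; rewrite big_cons.
have Qexp F k : Q F -> Q (fun t => F t ^+ k).
  move=> QF; elim: k => [|k IHk]; first exact: Qconst.
  rewrite (_ : (fun t => _) = fun t => F t * F t ^+ k); first exact: QM.
  by apply/funext => t; rewrite exprS.
rewrite (_ : (fun t => _) = fun t => \sum_(m <- mpoly.msupp p)
    mpoly.mcoeff m p * \prod_(i <- index_enum 'I_n) w t i ^+ mpoly.fun_of_multinom m i).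
  apply: Qsum => m; apply: QM; first exact: Qconst.
  by apply: Qprod => i; apply: Qexp.
by apply/funext => t; rewrite mpoly.mevalE.
Qed.
End PolynomialFunctions.

Section Laurent.
Variable R : realType.

(** Laurent polynomials, as functions on the nonzero reals; the values at [0] are
unconstrained. *)
Definition laurent (f : R -> R) : Prop :=
  exists (q : {poly R}) k, forall t, t != 0 -> f t = q.[t] / t ^+ k.

Lemma laurent_const c : laurent (fun=> c).
Proof. by exists c%:P, 0%N => t _; rewrite hornerC expr0 divr1. Qed.

Lemma laurent_id : laurent id.
Proof. by exists 'X, 0%N => t _; rewrite hornerX expr0 divr1. Qed.

Lemma laurentV : laurent (fun t => t^-1).
Proof. by exists 1, 1%N => t _; rewrite hornerC expr1 mul1r. Qed.

Lemma laurentD f g : laurent f -> laurent g -> laurent (fun t => f t + g t).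
Proof.
move=> [p [k fE]] [q [m gE]]; exists (p * 'X^m + q * 'X^k), (k + m)%N => t t0.
by rewrite fE// gE// !hornerE exprD; field; rewrite !expf_neq0.
Qed.

Lemma laurentM f g : laurent f -> laurent g -> laurent (fun t => f t * g t).
Proof.
move=> [p [k fE]] [q [m gE]]; exists (p * q), (k + m)%N => t t0.
by rewrite fE// gE// hornerM exprD; field; rewrite !expf_neq0.
Qed.

Lemma laurent_eq0 f (u : nat -> R) : laurent f -> injective u ->
  (forall n, u n != 0) -> (forall n, f (u n) = 0) -> forall t, t != 0 -> f t = 0.
Proof.
move=> [q [k fE]] u_inj u0 fu t t0; suff q0 : q = 0 by rewrite fE// q0 horner0 mul0r.
apply/eqP/negPn/negP => q0.
have := max_poly_roots (rs := [seq u n | n <- iota 0 (size q)]) q0.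
rewrite size_map size_iota ltnn map_inj_uniq// iota_uniq => /(_ _ isT) h.
suff : false by []; apply: h.
apply/allP => _ /mapP[n _ ->]; apply/rootP.
have /eqP := fu n; rewrite fE// mulf_eq0 invr_eq0 expf_eq0 (negPf (u0 n)) andbF orbF.
by move/eqP.
Qed.
End Laurent.

Section Closure.
Variables (R : realType) (A : set (SA R)).

Definition coord6 (X : 'M[R]_2) (s : 'cV[R]_2) (i : 'I_6) : R :=
  nth 0 [:: X 0 0; X 0 1; X 1 0; X 1 1; s 0 0; s 1 0] i.

(** Membership in the Zariski closure, for an affine map given by its linear part and
its translation part, so that no proof has to be carried along with families of
matrices of determinant one. *)
Definition in_closure X s : Prop := \det X = 1 /\
  forall p : mpoly.mpoly 6 R, (forall a, A a -> mpoly.meval (SA_coord a) p = 0) ->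
    mpoly.meval (coord6 X s) p = 0.

Lemma in_closureP x : zariski_closure A x <-> in_closure (theta x) (tau x).
Proof. by split=> [xA|[]//]; split; [exact: det_theta|exact: xA]. Qed.

Lemma closed_entries (T : Type) (Q : (T -> R) -> Prop) (X : T -> 'M[R]_2) (s : T -> 'cV[R]_2) :
  Q (fun t => X t 0 0) -> Q (fun t => X t 0 1) -> Q (fun t => X t 1 0) ->
  Q (fun t => X t 1 1) -> Q (fun t => s t 0 0) -> Q (fun t => s t 1 0) ->
  forall i, Q (fun t => coord6 (X t) (s t) i).
Proof. by move=> h0 h1 h2 h3 h4 h5; case=> -[|[|[|[|[|[|//]]]]]]. Qed.

(** A Laurent curve that meets the closure infinitely often is contained in it. *)
Lemma in_closure_curve (X : R -> 'M[R]_2) (s : R -> 'cV[R]_2) (u : nat -> R) :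
  (forall i j, laurent (fun t => X t i j)) -> (forall i, laurent (fun t => s t i 0)) ->
  (forall t, t != 0 -> \det (X t) = 1) ->
  injective u -> (forall n, u n != 0) ->
  (forall n, in_closure (X (u n)) (s (u n))) ->
  forall t, t != 0 -> in_closure (X t) (s t).
Proof.
move=> lX ls dX u_inj u0 Xu t t0; split; first exact: dX.
move=> p pA; apply: (laurent_eq0 (f := fun t => mpoly.meval (coord6 (X t) (s t)) p)) u_inj u0 _ _ t0.
  apply: meval_closed; [exact: laurent_const|exact: laurentD|exact: laurentM|].
  exact: closed_entries.
by move=> n; apply: (Xu n).2.
Qed.

Definition regular (f : SA R -> R) : Prop :=
  exists p : mpoly.mpoly 6 R, forall x, f x = mpoly.meval (SA_coord x) p.

Lemma regular_const c : regular (fun=> c).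
Proof. by exists (mpoly.mpolyC 6 c) => x; rewrite mpoly.mevalC. Qed.

Lemma regularD f g : regular f -> regular g -> regular (fun t => f t + g t).
Proof. by move=> [p fE] [q gE]; exists (p + q) => x; rewrite mpoly.mevalD fE gE. Qed.

Lemma regularM f g : regular f -> regular g -> regular (fun t => f t * g t).
Proof. by move=> [p fE] [q gE]; exists (p * q) => x; rewrite mpoly.mevalM fE gE. Qed.

Lemma regular_coord i : regular (fun x => SA_coord x i).
Proof. by exists (mpoly.mpolyX R (mpoly.mnm1 i)) => x; rewrite mpoly.mevalXU. Qed.

Lemma regular_theta i j : regular (fun x => theta x i j).
Proof.
have [->|->] := I2_cases i; have [->|->] := I2_cases j.
- exact: (regular_coord (@Ordinal 6 0 isT)).
- exact: (regular_coord (@Ordinal 6 1 isT)).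
- exact: (regular_coord (@Ordinal 6 2 isT)).
- exact: (regular_coord (@Ordinal 6 3 isT)).
Qed.

Lemma regular_tau i j : regular (fun x => tau x i j).
Proof.
rewrite (ord1 j); have [->|->] := I2_cases i.
- exact: (regular_coord (@Ordinal 6 4 isT)).
- exact: (regular_coord (@Ordinal 6 5 isT)).
Qed.

Definition regular_map (F : SA R -> SA R) : Prop :=
  (forall i j, regular (fun x => theta (F x) i j)) /\
  (forall i j, regular (fun x => tau (F x) i j)).

Lemma regular_mapP F p : regular_map F ->
  regular (fun x => mpoly.meval (SA_coord (F x)) p).
Proof.
move=> [Ft Fs]; apply: meval_closed; [exact: regular_const|exact: regularD|exact: regularM|].
exact: (@closed_entries _ regular (fun x => theta (F x)) (fun x => tau (F x))).
Qed.

Lemma closure_regular_map F : regular_map F ->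
  (forall a, A a -> zariski_closure A (F a)) ->
  forall x, zariski_closure A x -> zariski_closure A (F x).
Proof.
move=> rF FA x xA p pA; have [q qE] := regular_mapP p rF.
by rewrite qE; apply: xA => a Aa; rewrite -qE; apply: FA.
Qed.

Lemma regular_mull k : regular_map (fun x => k * x)%g.
Proof.
have regE f g : f =1 g -> regular g -> regular f by move=> /funext ->.
split=> i j.
- apply: (regE _ (fun x => theta k i 0 * theta x 0 j + theta k i 1 * theta x 1 j)).
    by move=> x; rewrite -mulmx2E.
  by apply: regularD; apply: regularM; (exact: regular_const || exact: regular_theta).
- apply: (regE _ (fun x => theta k i 0 * tau x 0 j + theta k i 1 * tau x 1 j + tau k i j)).
    by move=> x; rewrite -mulmx2E -addmx2E.
  apply: regularD; last exact: regular_const.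
  by apply: regularD; apply: regularM; (exact: regular_const || exact: regular_tau).
Qed.

Lemma regular_mulr k : regular_map (fun x => x * k)%g.
Proof.
have regE f g : f =1 g -> regular g -> regular f by move=> /funext ->.
split=> i j.
- apply: (regE _ (fun x => theta x i 0 * theta k 0 j + theta x i 1 * theta k 1 j)).
    by move=> x; rewrite -mulmx2E.
  by apply: regularD; apply: regularM; (exact: regular_const || exact: regular_theta).
- apply: (regE _ (fun x => theta x i 0 * tau k 0 j + theta x i 1 * tau k 1 j + tau x i j)).
    by move=> x; rewrite -mulmx2E -addmx2E.
  apply: regularD; last exact: regular_tau.
  by apply: regularD; apply: regularM; (exact: regular_const || exact: regular_theta).
Qed.

(** Translations being regular maps, the closure is first stable under the left
translations by elements of [A], and then under all right translations by its own elements. *)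
Lemma closure_mul : (forall a b, A a -> A b -> A (a * b)%g) ->
  forall x y, zariski_closure A x -> zariski_closure A y -> zariski_closure A (x * y)%g.
Proof.
move=> AM x y xA yA; apply: (closure_regular_map (regular_mulr y)) xA => a Aa.
apply: (closure_regular_map (regular_mull a)) yA => b Ab p pA; apply: pA.
exact: AM.
Qed.

Lemma in_closureM X s Y t : (forall a b, A a -> A b -> A (a * b)%g) ->
  in_closure X s -> in_closure Y t -> in_closure (X *m Y) (X *m t + s).
Proof.
move=> AM hX hY.
have mem Z w : in_closure Z w -> exists x, [/\ theta x = Z, tau x = w & zariski_closure A x].
  move=> hZ; have dZ : (Z, w) \in @SA_pred R by rewrite inE /=; apply/eqP; exact: hZ.1.
  by exists (MkSA dZ); split=> //; apply/in_closureP.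
have [x [<- <- xA]] := mem _ _ hX; have [y [<- <- yA]] := mem _ _ hY.
by apply/(in_closureP (x * y)%g); apply: closure_mul.
Qed.
End Closure.

(** * Two transverse tori generate SL2 *)

Section ToriGenerateSL2.
Variable R : realType.
(** [L0] stands for a Zariski closed submonoid of SL2 that contains the diagonal torus
as well as the matrix [M] below, hence the conjugate torus. *)
Variable L0 : 'M[R]_2 -> Prop.
Hypothesis L0M : forall X Y, L0 X -> L0 Y -> L0 (X *m Y).
Hypothesis L0_curve : forall (X : R -> 'M[R]_2) (u : nat -> R),
  (forall i j, laurent (fun t => X t i j)) -> (forall t, t != 0 -> \det (X t) = 1) ->
  injective u -> (forall n, u n != 0) -> (forall n, L0 (X (u n))) ->
  forall t, t != 0 -> L0 (X t).
Hypothesis L0_diag : forall t, t != 0 -> L0 (mx2 t 0 0 t^-1).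

Lemma laurent_mx2 (a b c d : R -> R) : laurent a -> laurent b -> laurent c -> laurent d ->
  forall i j, laurent (fun t => mx2 (a t) (b t) (c t) (d t) i j).
Proof.
move=> la lb lc ld i j.
have ext f g : g =1 f -> laurent f -> laurent g by move=> /funext ->.
by have [->|->] := I2_cases i; have [->|->] := I2_cases j;
   apply: ext; [move=> t; rewrite mx2_entries; reflexivity| |
     move=> t; rewrite mx2_entries; reflexivity| |
     move=> t; rewrite mx2_entries; reflexivity| |
     move=> t; rewrite mx2_entries; reflexivity| ].
Qed.

(** Multiplying on both sides by diagonal matrices reaches these entries when [m n] is
positive, and the restriction on the sign is removed by closedness. *)
Lemma diagonal_orbit (c : 'M[R]_2) m n : L0 c -> \det c = 1 -> m != 0 -> n != 0 ->
  L0 (mx2 (m * c 0 0) (n * c 0 1) (c 1 0 / n) (c 1 1 / m)).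
Proof.
move=> Lc dc m0 n0; have ec := det_eq1 dc.
pose X t := mx2 (m * c 0 0) (m * t * c 0 1) (c 1 0 / (m * t)) (c 1 1 / m).
suff h t : t != 0 -> L0 (X t).
  have -> : n = m * (n / m) by rewrite mulrC divfK.
  by apply: h; rewrite mulf_neq0 ?invr_eq0.
apply: (L0_curve (u := fun k => k.+1%:R ^+ 2)).
- apply: laurent_mx2.
  + exact: laurent_const.
  + apply: laurentM; last exact: laurent_const.
    by apply: laurentM; [exact: laurent_const|exact: laurent_id].
  + rewrite (_ : (fun t => _) = fun t => c 1 0 / m * t^-1).
      by apply: laurentM; [exact: laurent_const|exact: laurentV].
    by apply/funext => s; rewrite invfM mulrA.
  + exact: laurent_const.
- move=> s s0; rewrite !mx2E.
  rewrite [LHS](_ : _ = c 0 0 * c 1 1 - c 0 1 * c 1 0); last by field; rewrite m0 s0.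
  by rewrite ec addrK.
- move=> i j /eqP; rewrite eqrXn2// => /eqP /eqP; rewrite eqr_nat => /eqP.
  by case.
- by move=> k; rewrite expf_neq0// pnatr_eq0.
move=> k; have : k.+1%:R != 0 :> R by rewrite pnatr_eq0.
move: k.+1%:R => r r0.
rewrite (_ : X _ = mx2 (m * r) 0 0 (m * r)^-1 *m c *m mx2 r^-1 0 0 r^-1^-1).
  by apply: L0M; [apply: L0M => //|]; apply: L0_diag; rewrite ?mulf_neq0 ?invr_eq0.
by apply: mx2_eq; rewrite /X !mx2E; field; rewrite ?m0 ?r0.
Qed.

Variable M : 'M[R]_2.
Hypotheses (dM : \det M = 1) (LM : L0 M) (LM' : L0 (\adj M)).
Hypotheses (M01 : M 0 1 * M 1 0 != 0) (M00 : M 0 0 * M 1 1 != 0).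

(** The product of the off-diagonal entries runs over all numbers of a given sign
when [s] varies, since [s - 1 / s] takes all real values. *)
Lemma conj_torus s : s != 0 -> let c := \adj M *m mx2 s 0 0 s^-1 *m M in
  [/\ L0 c, \det c = 1 &
    c 0 1 * c 1 0 = - (M 0 0 * M 1 1 * (M 0 1 * M 1 0)) * (s - s^-1) ^+ 2].
Proof.
move=> s0 c; split.
- by apply: L0M => //; apply: L0M => //; apply: L0_diag.
- rewrite /c !det_mulmx dM mulr1.
  have -> : \det (\adj M) = \det M by rewrite !mx2E; ring.
  by rewrite dM mul1r !mx2E mulr0 subr0 divff.
- by rewrite /c !mx2E; move: s^-1 => t; ring.
Qed.

Lemma torus_parameter (x : R) : exists2 s : R, s != 0 & s - s^-1 = x.
Proof.
pose r := Num.sqrt (x ^+ 2 + 4).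
have r2 : r ^+ 2 = x ^+ 2 + 4 by rewrite sqr_sqrtr// addr_ge0 ?sqr_ge0.
have r0 : 0 <= r by exact: sqrtr_ge0.
have s0 : (x + r) / 2 != 0.
  rewrite gt_eqF// divr_gt0//; rewrite -(opprK x) addrC subr_gt0.
  by rewrite (le_lt_trans (ler_norm _))// -ltr_sqr ?nnegrE// r2 real_normK ?num_real// sqrrN; lra.
exists ((x + r) / 2) => //; apply: (mulfI s0); rewrite mulrBr divff//.
lra.
Qed.

(** The double coset of the conjugate torus by the diagonal one contains all matrices
with nonzero entries for which the product of the off-diagonal entries has
the right sign; the condition on the sign is removed by closedness again. *)
Lemma generic_in (Y : 'M[R]_2) : \det Y = 1 -> Y 0 0 != 0 -> Y 0 1 != 0 -> Y 1 0 != 0 -> L0 Y.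
Proof.
set K := M 0 0 * M 1 1 * (M 0 1 * M 1 0).
have K0 : K != 0 by rewrite mulf_neq0.
have cone (x y z : R) : x != 0 -> y != 0 -> z != 0 -> 1 + y * z != 0 ->
    0 <= - (y * z) / K -> L0 (mx2 x y z ((1 + y * z) / x)).
  move=> x0 y0 z0 w0 yz0; have [s s0 sE] := torus_parameter (Num.sqrt (- (y * z) / K)).
  have [Lc dc] := conj_torus s0; rewrite -/K sE sqr_sqrtr//.
  set c := _ *m _ *m M in Lc dc *; rewrite mulNr mulrCA divff// mulr1 opprK => c01.
  have c01N0 : c 0 1 * c 1 0 != 0 by rewrite c01 mulf_neq0.
  have c00 : c 0 0 * c 1 1 = 1 + y * z by rewrite -c01 det_eq1.
  have c00N0 : c 0 0 * c 1 1 != 0 by rewrite c00.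
  clearbody c; move: c01N0 c00N0; rewrite !mulf_eq0 !negb_or => /andP[cy cz] /andP[cx cw].
  have := diagonal_orbit Lc dc (m := x / c 0 0) (n := y / c 0 1).
  rewrite !mulf_neq0 ?invr_eq0// => /(_ isT isT).
  congr L0; apply: mx2_eq; rewrite !mx2E ?divfK//.
    by rewrite invf_div mulrA (mulrC (c 1 0)) c01 mulrC mulKf.
  by rewrite invf_div mulrA (mulrC (c 1 1)) c00.
move=> dY x0 y0 z0; have eY := det_eq1 dY.
pose X t := mx2 (Y 0 0) (Y 0 1) t ((1 + Y 0 1 * t) / Y 0 0).
have -> : Y = X (Y 1 0).
  by apply: mx2_eq; rewrite /X !mx2E// -eY mulrC mulKf.
(* K * tau n is never 1, so that the fourth entry does not vanish *)
pose tau n : R := n.+2%:R / `|K|.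
have tau0 n : 0 < tau n by rewrite divr_gt0 ?ltr0n// normr_gt0.
apply: (L0_curve (u := fun n => - (K * tau n) / Y 0 1)) z0.
- apply: laurent_mx2; [exact: laurent_const|exact: laurent_const|exact: laurent_id|].
  apply: laurentM; last exact: laurent_const.
  apply: laurentD; first exact: laurent_const.
  by apply: laurentM; [exact: laurent_const|exact: laurent_id].
- by move=> t _; rewrite /X !mx2E; field.
- move=> i j; rewrite /tau => /(mulIf _); rewrite invr_eq0 => /(_ y0) /oppr_inj.
  move=> /(mulfI K0) /(mulIf _); rewrite invr_eq0 normr_eq0 => /(_ K0) /eqP.
  by rewrite eqr_nat => /eqP[].
- by move=> n; rewrite mulf_neq0 ?invr_eq0// oppr_eq0 mulf_neq0// gt_eqF.
move=> n; have yt : Y 0 1 * (- (K * tau n) / Y 0 1) = - (K * tau n) by rewrite mulrC divfK.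
apply: cone => //; rewrite ?yt.
- by rewrite mulf_neq0 ?invr_eq0// oppr_eq0 mulf_neq0// gt_eqF.
- rewrite subr_eq0; apply/eqP => /(congr1 Num.norm); rewrite normr1 normrM.
  rewrite (gtr0_norm (tau0 n)) /tau mulrC divfK ?normr_eq0// => /eqP.
  by rewrite eq_sym pnatr_eq1.
- by rewrite opprK mulrC mulKf ?ltW//; exact: tau0.
Qed.

(** The three entries that have to be nonzero in [generic_in] are so in [Y N] and in the
inverse of [N], for a suitable integral [N]. *)
Lemma tori_generate (Y : 'M[R]_2) : \det Y = 1 -> L0 Y.
Proof.
move=> dY; have eY := det_eq1 dY.
have [m [m0 m1 m2]] : exists m : nat, [/\ (0 < m)%N, Y 0 0 + m%:R * Y 0 1 != 0 &
    Y 1 0 + m%:R * Y 1 1 != 0].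
  apply: contrapT => no.
  have bad (m : nat) : (0 < m)%N -> Y 0 0 + m%:R * Y 0 1 = 0 \/ Y 1 0 + m%:R * Y 1 1 = 0.
    move=> m0; apply: contrapT => /not_orP[/eqP h1 /eqP h2].
    by apply: no; exists m.
  have top (i j : R) : j - i != 0 -> Y 0 0 + i * Y 0 1 = 0 -> Y 0 0 + j * Y 0 1 = 0 -> False.
    move=> ij h1 h2; have y01 : Y 0 1 = 0 by apply: (mulfI ij); rewrite mulr0; lra.
    have y00 : Y 0 0 = 0 by move: h1; rewrite y01 mulr0 addr0.
    by move: eY; rewrite y00 y01 !mul0r addr0 => /esym/eqP; rewrite oner_eq0.
  have bot (i j : R) : j - i != 0 -> Y 1 0 + i * Y 1 1 = 0 -> Y 1 0 + j * Y 1 1 = 0 -> False.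
    move=> ij h1 h2; have y11 : Y 1 1 = 0 by apply: (mulfI ij); rewrite mulr0; lra.
    have y10 : Y 1 0 = 0 by move: h1; rewrite y11 mulr0 addr0.
    by move: eY; rewrite y10 y11 !mulr0 addr0 => /esym/eqP; rewrite oner_eq0.
  have d12 : 2 - 1 != 0 :> R by apply/eqP; lra.
  have d13 : 3 - 1 != 0 :> R by apply/eqP; lra.
  have d23 : 3 - 2 != 0 :> R by apply/eqP; lra.
  have [b1|b1] := bad 1%N isT; have [b2|b2] := bad 2%N isT; have [b3|b3] := bad 3%N isT;
    solve [exact: (top _ _ d12 b1 b2) | exact: (top _ _ d13 b1 b3) | exact: (top _ _ d23 b2 b3)
          |exact: (bot _ _ d12 b1 b2) | exact: (bot _ _ d13 b1 b3) | exact: (bot _ _ d23 b2 b3)].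
have [n [n0 n1]] : exists n : nat, (0 < n)%N /\
    n%:R * (Y 0 0 + m%:R * Y 0 1) + Y 0 1 != 0.
  have [h|h] := eqVneq (1 * (Y 0 0 + m%:R * Y 0 1) + Y 0 1) 0; last by exists 1%N.
  exists 2%N; split=> //; apply: contraNneq m1 => h2; apply/eqP; lra.
pose N : 'M[R]_2 := mx2 1 n%:R m%:R (1 + m%:R * n%:R).
pose N' : 'M[R]_2 := mx2 (1 + m%:R * n%:R) (- n%:R) (- m%:R) 1.
have -> : Y = (Y *m N) *m N'.
  by rewrite -mulmxA (_ : N *m N' = 1%:M) ?mulmx1//; apply: mx2_eq; rewrite !mx2E; ring.
have mn0 : 1 + m%:R * n%:R != 0 :> R by rewrite -natrM nat1r pnatr_eq0.
have [m0' n0'] : m%:R != 0 :> R /\ n%:R != 0 :> R by rewrite !pnatr_eq0 -!lt0n.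
apply: L0M; apply: generic_in.
- by rewrite det_mulmx dY !mx2E; ring.
- by rewrite !mx2E mulr1 mulrC.
- by rewrite !mx2E; apply: contraNneq n1 => h; apply/eqP; lra.
- by rewrite !mx2E mulr1 mulrC.
- by rewrite !mx2E; ring.
- by rewrite mx2_entries.
- by rewrite mx2_entries oppr_eq0.
- by rewrite mx2_entries oppr_eq0.
Qed.
End ToriGenerateSL2.

(** * Zariski density *)

Section Density.
Variables (R : realType) (gT : groupType) (v : gT -> SA int).
Hypothesis vM : forall x y, v (x * y)%g = (v x * v y)%g.
Variable H : subgroup gT.
Local Notation rot := (linear_part R v).
Local Notation trans h := (tau (SA_real R (v h))).
Let A : set (SA R) := SA_real R @` (v @` carrier H).
Local Notation Cl := (in_closure A).

Let AM : forall a b, A a -> A b -> A (a * b)%g.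
Proof.
move=> _ _ [_ [h Hh <-] <-] [_ [k Hk <-] <-]; exists (v (h * k)%g).
  by exists (h * k)%g => //; exact: subgroupM.
by rewrite vM SA_realM.
Qed.

Let ClM X s Y t : Cl X s -> Cl Y t -> Cl (X *m Y) (X *m t + s).
Proof. exact: in_closureM. Qed.

Let ClH h : carrier H h -> Cl (rot h) (trans h).
Proof.
move=> Hh; apply/in_closureP => p pA; apply: pA.
by exists (v h) => //; exists h.
Qed.

Let rot1 : rot 1%g = 1%:M.
Proof. exact: linear_part1. Qed.

Let trans1 : trans 1%g = 0.
Proof. by rewrite (morphism1 vM) /tau /= map_mx0. Qed.

Let rotV h : rot h *m rot h^-1%g = 1%:M.
Proof. exact: linear_partVK. Qed.

Lemma transM h k : trans (h * k)%g = rot h *m trans k + trans h.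
Proof. by rewrite vM SA_realM. Qed.

Let transV h : rot h *m trans h^-1%g = - trans h.
Proof. by apply/eqP; rewrite -addr_eq0 -transM mulgV trans1. Qed.

Lemma closure_conj h X s : carrier H h -> Cl X s ->
  Cl (rot h *m X *m rot h^-1%g) (rot h *m (X *m trans h^-1%g + s) + trans h).
Proof.
move=> Hh Xs; have := ClM (ClH Hh) (ClM Xs (ClH (subgroupV Hh))).
by rewrite mulmxA.
Qed.

(** [(- 1, 2 p)] is the reflection through the point [p]. *)
Lemma closure_reflection h p : carrier H h -> Cl (- 1%:M) (p *+ 2) ->
  Cl (- 1%:M) (action v h p *+ 2).
Proof.
move=> Hh /(closure_conj Hh); rewrite mulmxN mulmx1 mulNmx rotV.
rewrite mulNmx mul1mx mulmxDr mulmxN transV opprK !mulr2n mulmxDr.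
by rewrite addrAC addrC -addrACA.
Qed.

Lemma closure_translation_of_reflections p q :
  Cl (- 1%:M) (p *+ 2) -> Cl (- 1%:M) (q *+ 2) -> Cl 1%:M ((p - q) *+ 2).
Proof.
move=> hp hq; have := ClM hp hq.
by rewrite mulNmx mul1mx opprK mulNmx mul1mx mulrnBl addrC.
Qed.

(** The positive integral multiples of [d] already give infinitely many points of this
line. *)
Lemma closure_translation_line d : Cl 1%:M d -> forall t, Cl 1%:M (t *: d).
Proof.
move=> hd; have step n : Cl 1%:M (n.+1%:R *: d).
  elim: n => [|n IHn]; first by rewrite scale1r.
  have := ClM hd IHn; rewrite !mul1mx; congr Cl.
  by rewrite -[X in _ + X]scale1r -scalerDl natr1.
move=> t; have [->|t0] := eqVneq t 0.
  by rewrite scale0r -rot1 -trans1; apply: ClH; exact: subgroup1.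
apply: (in_closure_curve (X := fun=> 1%:M) (s := fun t => t *: d) (u := fun n => n.+1%:R)) t0 => //.
- by move=> i j; exact: laurent_const.
- move=> i; rewrite (_ : (fun t => _) = fun t => t * d i 0); last first.
    by apply/funext => r; rewrite mxE.
  by apply: laurentM; [exact: laurent_id|exact: laurent_const].
- by move=> *; rewrite det1.
- by move=> i j /eqP; rewrite eqr_nat => /eqP[].
Qed.

Lemma closure_translation_conj h d : carrier H h -> Cl 1%:M d -> Cl 1%:M (rot h *m d).
Proof.
move=> Hh /(closure_conj Hh); rewrite mulmx1 rotV mul1mx mulmxDr transV.
by rewrite addrAC addNr add0r.
Qed.

(** The nilpotent matrix whose image and kernel are spanned by [d]. *)
Definition null_vector_mx (d : 'cV[R]_2) : 'M[R]_2 :=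
  mx2 (d 0 0 * d 1 0) (- d 0 0 ^+ 2) (d 1 0 ^+ 2) (- (d 0 0 * d 1 0)).

Lemma eigenvector_normalizes (T : 'M[R]_2) (d : 'cV[R]_2) m :
  \det T = 1 -> T *m d = m *: d -> normalizes_line (null_vector_mx d) T.
Proof.
move=> dT Td; have eT := det_eq1 dT.
have h0 : T 0 0 * d 0 0 + T 0 1 * d 1 0 = m * d 0 0.
  by have /matrixP/(_ 0 0) := Td; rewrite !mx2E.
have h1 : T 1 0 * d 0 0 + T 1 1 * d 1 0 = m * d 1 0.
  by have /matrixP/(_ 1 0) := Td; rewrite !mx2E.
have row0 : m * (d 1 0 * T 0 0 - d 0 0 * T 1 0) = d 1 0.
  rewrite [LHS](_ : _ = T 0 0 * (m * d 1 0) - T 1 0 * (m * d 0 0)); last by ring.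
  rewrite -h0 -h1 [LHS](_ : _ = d 1 0 * (T 0 0 * T 1 1 - T 0 1 * T 1 0)); last by ring.
  by rewrite eT addrK mulr1.
have row1 : m * (d 1 0 * T 0 1 - d 0 0 * T 1 1) = - d 0 0.
  rewrite [LHS](_ : _ = T 0 1 * (m * d 1 0) - T 1 1 * (m * d 0 0)); last by ring.
  rewrite -h0 -h1 [LHS](_ : _ = - (d 0 0 * (T 0 0 * T 1 1 - T 0 1 * T 1 0))); last by ring.
  by rewrite eT addrK mulr1.
exists (m ^+ 2); apply: mx2_eq; rewrite /null_vector_mx !mx2E.
- rewrite [LHS](_ : _ = (T 0 0 * d 0 0 + T 0 1 * d 1 0) * d 1 0); last by ring.
  by rewrite h0 -[X in _ * X = _]row0; ring.
- rewrite [LHS](_ : _ = (T 0 0 * d 0 0 + T 0 1 * d 1 0) * (- d 0 0)); last by ring.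
  by rewrite h0 -[X in _ * X = _]row1; ring.
- rewrite [LHS](_ : _ = (T 1 0 * d 0 0 + T 1 1 * d 1 0) * d 1 0); last by ring.
  by rewrite h1 -[X in _ * X = _]row0; ring.
- rewrite [LHS](_ : _ = (T 1 0 * d 0 0 + T 1 1 * d 1 0) * (- d 0 0)); last by ring.
  by rewrite h1 -[X in _ * X = _]row1; ring.
Qed.

Hypothesis H_moves_lines : forall X : 'M[R]_2, X != 0 -> \tr X = 0 ->
  exists2 h, carrier H h & moves_line v X h.
Hypothesis H_moves_points : forall p : 'cV[R]_2, exists2 h, carrier H h & action v h p <> p.

Lemma null_vector_mx_neq0 d : d != 0 -> null_vector_mx d != 0.
Proof.
apply: contraNneq => /matrixP N0; have := (N0 0 1, N0 1 0).
rewrite !mx2E !mxE => -[/eqP + /eqP]; rewrite oppr_eq0 !sqrf_eq0 => /eqP d0 /eqP d1.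
by apply/eqP; apply: cV2_eq; rewrite [RHS]mxE.
Qed.

Lemma independent_vectors_span (d e w : 'cV[R]_2) : d != 0 -> (forall m, e <> m *: d) ->
  exists x y, w = x *: d + y *: e.
Proof.
move=> d0 ed; set D := d 0 0 * e 1 0 - d 1 0 * e 0 0.
have D0 : D != 0.
  apply/eqP => D0; have [d00|d00] := eqVneq (d 0 0) 0.
    have d10 : d 1 0 != 0.
      by apply: contraNneq d0 => d10; apply/eqP; apply: cV2_eq; rewrite [RHS]mxE.
    apply: (ed (e 1 0 / d 1 0)); apply: cV2_eq; rewrite mx2E ?divfK// d00 mulr0.
    apply: (mulfI d10); move: D0; rewrite /D d00 mul0r sub0r mulr0 => /eqP.
    by rewrite oppr_eq0 => /eqP.
  apply: (ed (e 0 0 / d 0 0)); apply: cV2_eq; rewrite mx2E ?divfK//.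
  apply: (mulfI d00); rewrite [RHS](_ : _ = d 1 0 * e 0 0); last by field.
  by apply/eqP; rewrite -subr_eq0 -/D; apply/eqP.
exists ((w 0 0 * e 1 0 - w 1 0 * e 0 0) / D), ((d 0 0 * w 1 0 - d 1 0 * w 0 0) / D).
by apply: cV2_eq; rewrite !mx2E /D; field.
Qed.

(** The directions of translations in the closure are permuted by [H], which has no
invariant line in the plane: such a line would give an invariant nilpotent line
of sl2. *)
Lemma closure_all_translations d : d != 0 -> Cl 1%:M d -> forall w, Cl 1%:M w.
Proof.
move=> d0 hd w.
have [h Hh mv] : exists2 h, carrier H h & moves_line v (null_vector_mx d) h.
  apply: H_moves_lines; first exact: null_vector_mx_neq0.
  by rewrite mx2E !mx2_entries subrr.
have [||x [y ->]] := @independent_vectors_span d (rot h *m d) w => //.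
  by move=> m hm; apply: mv; apply: eigenvector_normalizes hm; rewrite det_linear_part.
have := ClM (closure_translation_line (closure_translation_conj Hh hd) y)
  (closure_translation_line hd x).
by rewrite !mul1mx.
Qed.

Lemma traceless_hyperbolic_neq0 a : 7 <= \tr (rot a) -> traceless (rot a) != 0.
Proof.
move=> tra; apply/eqP => a0.
have h00 : traceless (rot a) 0 0 = 0 by rewrite a0 mxE.
have h01 : traceless (rot a) 0 1 = 0 by rewrite a0 mxE.
rewrite !tracelessE in h00 h01.
have := det_eq1 (det_linear_part R v a); rewrite h01 mul0r addr0.
by move: tra h00; rewrite mx2E; move: (rot a 0 0) (rot a 1 1) => y z; nra.
Qed.

(** The powers of a hyperbolic [a] in [H] are Zariski dense in the torus that fixes the centre
[p] of [a]. The element [- 1] of this torus is the reflection through [p]; composed with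
the reflection through another point [h p] it is a translation. Once all the
translations are there, the linear parts can be considered alone, and they contain
two transverse tori. *)
Lemma zariski_dense x : zariski_closure A x.
Proof.
have [a Ha tra] : exists2 a, carrier H a & 7 <= \tr (rot a).
  have [s [t [Hs Ht [hyp|hyp]]]] := hyperbolic_word vM H_moves_lines;
    [exists (s * s)%g|eexists; last exact: hyp] => //.
    exact: subgroupM.
  by apply: subgroupM; do !apply: subgroupM => //; exact: subgroupV.
have [g Hg mv] := H_moves_lines (traceless_hyperbolic_neq0 tra) (tr_traceless _).
have [p ap] := hyperbolic_fixed_point tra.
have [l [P /= [l6 Pu Pa dM]]] := eigenframe vM tra mv.
set M := P *m _ *m _ in dM *; move=> [M01 M00 _ _].
have l0 : l != 0 by rewrite gt_eqF// (lt_le_trans _ l6).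
have PV : invmx P *m P = 1%:M by exact: mulVmx.
have VP : P *m invmx P = 1%:M by exact: mulmxV.
pose D t : 'M[R]_2 := mx2 t 0 0 t^-1.
pose cj (X : 'M[R]_2) := invmx P *m X *m P.
have cjM X Y : cj X *m cj Y = cj (X *m Y).
  by rewrite /cj !mulmxA -(mulmxA _ P (invmx P)) VP mulmx1.
have det_cj X : \det (cj X) = \det X.
  by rewrite /cj !det_mulmx mulrAC -det_mulmx PV det1 mul1r.
have detD t : t != 0 -> \det (D t) = 1 by move=> t0; rewrite !mx2E mulr0 subr0 divff.
have aE : rot a = cj (D l) by rewrite /cj -mulmxA -Pa mulmxA PV mul1mx.
have anE n : rot (a ^+ n)%g = cj (D (l ^+ n)).
  elim: n => [|n IHn].
    rewrite expg0 rot1 /cj expr0 (_ : D 1 = 1%:M) ?mulmx1 ?PV//.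
    by apply: mx2_eq; rewrite !mx2E ?invr1.
  rewrite expgS linear_partM// aE IHn cjM; congr cj.
  by apply: mx2_eq; rewrite !mx2E ?exprS ?invfM; ring.
have anp n : action v (a ^+ n)%g p = p.
  by elim: n => [|n IHn]; rewrite ?expg0 ?action1// expgS actionM// IHn.
have an_in n : carrier H (a ^+ n)%g.
  by elim: n => [|n IHn]; [exact: subgroup1|rewrite expgS; exact: subgroupM].
have cj_laurent (X : R -> 'M[R]_2) : (forall i j, laurent (fun t => X t i j)) ->
    forall i j, laurent (fun t => cj (X t) i j).
  move=> lX i j; rewrite (_ : (fun t => _) = fun t =>
    (invmx P i 0 * X t 0 0 + invmx P i 1 * X t 1 0) * P 0 j +
    (invmx P i 0 * X t 0 1 + invmx P i 1 * X t 1 1) * P 1 j); last first.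
    by apply/funext => t; rewrite /cj !mulmx2E.
  by do !(apply: laurentD || apply: laurentM || exact: laurent_const || exact: lX).
have D_laurent i j : laurent (fun t => D t i j).
  by apply: laurent_mx2; (exact: laurent_id || exact: laurent_const || exact: laurentV).
have l_inj : injective (fun n => l ^+ n).
  have l1 : 1 < l by apply: lt_le_trans l6; lra.
  move=> m n lmn; case: (ltngtP m n) => // mn; move: mn.
    by rewrite -(ltr_eXn2l l1) lmn ltxx.
  by rewrite -(ltr_eXn2l l1) lmn ltxx.
have ln0 n : l ^+ n != 0 by rewrite expf_neq0.
have torus : forall t, t != 0 -> Cl (cj (D t)) (p - cj (D t) *m p).
  apply: (in_closure_curve (X := fun t => cj (D t)) (s := fun t => p - cj (D t) *m p)) l_inj ln0 _.
  - exact: cj_laurent.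
  - move=> i; rewrite (_ : (fun t => _) = fun t =>
      p i 0 + -1 * (cj (D t) i 0 * p 0 0 + cj (D t) i 1 * p 1 0)); last first.
      by apply/funext => r; rewrite addmx2E oppmx2E mulmx2E mulN1r.
    by do !(apply: laurentD || apply: laurentM || exact: laurent_const || exact: cj_laurent).
  - by move=> r r0; rewrite det_cj detD.
  move=> n; have := ClH (an_in n); rewrite anE; congr Cl.
  have E := anp n; rewrite /action /affine -[theta _]/(rot _) anE in E.
  by rewrite -{1}E addrAC subrr add0r.
have refl : Cl (- 1%:M) (p *+ 2).
  have N1 : -1 != 0 :> R by rewrite oppr_eq0 oner_eq0.
  have := torus _ N1; have -> : cj (D (-1)) = - 1%:M.
    rewrite /cj (_ : D (-1) = - 1%:M) ?mulmxN ?mulmx1 ?mulNmx ?PV//.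
    by apply: mx2_eq; rewrite !mx2E ?invrN1 ?oppr0.
  by rewrite mulNmx mul1mx opprK mulr2n.
have transl : forall w, Cl 1%:M w.
  have [h Hh hp] := H_moves_points p.
  apply: closure_all_translations (closure_translation_of_reflections (closure_reflection Hh refl) refl).
  by rewrite -scaler_nat scaler_eq0 pnatr_eq0 subr_eq0; apply/eqP.
have any_translation X s1 s2 : Cl X s1 -> Cl X s2.
  by move=> h; have := ClM (transl (s2 - s1)) h; rewrite !mul1mx addrC subrK.
pose L0 X := Cl (cj X) 0.
have L0M X Y : L0 X -> L0 Y -> L0 (X *m Y).
  by move=> hX hY; rewrite /L0 -cjM; apply: any_translation (ClM hX hY).
have LM : L0 M.
  have ME : cj M = rot g^-1%g by rewrite /cj /M !mulmxA PV mul1mx -mulmxA PV mulmx1.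
  by rewrite /L0 ME; apply: any_translation (ClH (subgroupV Hg)).
have LM' : L0 (\adj M).
  have ME : cj (\adj M) = rot g.
    have M1 : \adj M *m M = 1%:M by rewrite mul_adj_mx dM.
    have cj1 : cj 1%:M = 1%:M by rewrite /cj mulmx1 PV.
    have cjM' : cj M = rot g^-1%g.
      by rewrite /cj /M !mulmxA PV mul1mx -mulmxA PV mulmx1.
    rewrite -[LHS]mulmx1 -(rotV g^-1%g) invgK mulmxA -cjM' cjM M1 cj1.
    exact: mul1mx.
  by rewrite /L0 ME; apply: any_translation (ClH Hg).
apply/in_closureP; apply: (any_translation _ _ _ (_ : Cl (theta x) 0)).
have -> : theta x = cj (P *m theta x *m invmx P).
  by rewrite /cj !mulmxA PV mul1mx -mulmxA PV mulmx1.
apply: (tori_generate L0M _ _ dM LM LM' M01 M00).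
- move=> X u lX dX u_inj u0 Xu t0 t0N; rewrite /L0.
  apply: (in_closure_curve (X := fun t => cj (X t)) (s := fun=> 0)) u_inj u0 Xu _ t0N.
  + exact: cj_laurent.
  + by move=> i; rewrite (_ : (fun t => _) = fun=> 0); [exact: laurent_const|apply/funext => r; rewrite mxE].
  + by move=> r r0; rewrite det_cj dX.
- by move=> r r0; apply: any_translation (torus r r0).
- by rewrite !det_mulmx mulrAC -det_mulmx VP det1 mul1r det_theta.
Qed.
End Density.

(** * Generating sets *)

Section GeneratingSets.
Variables (R : realType) (gT : groupType) (v : gT -> SA int).
Hypothesis vM : forall x y, v (x * y)%g = (v x * v y)%g.
Local Notation rot := (linear_part R v).

Definition line_stabilizer (X : 'M[R]_2) (X0 : X != 0) : subgroup gT.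
Proof.
apply: (@Subgroup _ [set g | normalizes_line X (rot g)]) => /=.
- by rewrite (linear_part1 R vM); exact: normalizes_line1.
- by move=> x y hx hy; rewrite linear_partM//; exact: normalizes_lineM.
- move=> x hx; rewrite linear_partV//; apply: normalizes_line_adj => //.
  exact: det_linear_part.
Defined.

Definition point_stabilizer (p : 'cV[R]_2) : subgroup gT.
Proof.
apply: (@Subgroup _ [set g | action v g p = p]) => /=.
- exact: action1.
- by move=> x y hx hy; rewrite actionM// hy.
- by move=> x hx; rewrite -{1}hx actionK.
Defined.

Lemma generated_sub (S : set gT) (K : subgroup gT) :
  generated S = setT -> S `<=` carrier K -> forall g, carrier K g.
Proof. by move=> gS SK g; have h : generated S g; [rewrite gS|exact: h]. Qed.

Lemma generators_move_lines (S : set gT) : generated S = setT ->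
  injective v -> ~ virtually_solvable gT ->
  forall X : 'M[R]_2, X != 0 -> \tr X = 0 -> exists2 s, S s & moves_line v X s.
Proof.
move=> gS v_inj nvs X X0 trX; apply: contrapT => no; apply: nvs.
apply: (@solvable_of_line R gT (fun g => SA_real R (v g)) _ _ X X0 trX).
- by move=> x y; rewrite vM SA_realM.
- by move=> x y /(@SA_real_inj R)/v_inj.
apply: (generated_sub (K := line_stabilizer X0)) gS _ => s Ss /=.
by apply: contrapT => mv; apply: no; exists s.
Qed.

Lemma generators_move_points (S : set gT) : generated S = setT ->
  ~ (exists p : 'cV[R]_2, forall g, action v g p = p) ->
  forall p : 'cV[R]_2, exists2 s, S s & action v s p <> p.
Proof.
move=> gS nfix p; apply: contrapT => no; apply: nfix; exists p.
apply: (generated_sub (K := point_stabilizer p)) gS _ => s Ss /=.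
by apply: contrapT => mv; apply: no; exists s.
Qed.

Variables (H : subgroup gT) (f : l2 R (quot H)) (S : set gT) (d : R).
Hypothesis f1 : `|f| = 1.
Hypothesis dS : forall s, S s -> displacement f s <= d.
(** The words used below have length at most [2 + 8 + 2]. *)
Hypothesis d_small : 9 * (9 * (12 * d)) <= 10^-1.
Hypothesis S_lines : forall X : 'M[R]_2, X != 0 -> \tr X = 0 ->
  exists2 s, S s & moves_line v X s.
Hypothesis S_points : forall p : 'cV[R]_2, exists2 s, S s & action v s p <> p.

(** If [b] moves the line of [a] and [s] its centre [p], then [b], [s] or [b s] moves
both. *)
Lemma short_hyperbolic_pair : exists a g (p : 'cV[R]_2),
  [/\ barely_moves f a, barely_moves f (g * a * g^-1)%g, 7 <= \tr (rot a),
      moves_line v (traceless (rot a)) g & action v a p = p /\ action v g p <> p].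
Proof.
have dM x y m n : displacement f x <= m * d -> displacement f y <= n * d ->
    displacement f (x * y)%g <= (m + n) * d.
  by move=> hx hy; rewrite mulrDl; apply: le_trans (displacementM _ _ _) (lerD hx hy).
have dV x m : displacement f x <= m * d -> displacement f x^-1%g <= m * d.
  by rewrite displacementV.
have d1 s : S s -> displacement f s <= 1 * d by rewrite mul1r; exact: dS.
have d0 : 0 <= d.
  have [s Ss _] := S_points 0; apply: le_trans (dS Ss); exact: normr_ge0.
have [a tra da] : exists2 a, 7 <= \tr (rot a) & displacement f a <= 8 * d.
  have [s [t [Ss St [hyp|hyp]]]] := hyperbolic_word vM S_lines.
    exists (s * s)%g => //; apply: le_trans (dM _ _ _ _ (d1 _ Ss) (d1 _ Ss)) _.
    by rewrite ler_wpM2r//; lra.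
  eexists; first exact: hyp.
  have dw : displacement f (s * t * s^-1 * t^-1)%g <= (1 + 1 + 1 + 1) * d.
    have dst := dM _ _ _ _ (d1 _ Ss) (d1 _ St).
    exact: (dM _ _ _ _ (dM _ _ _ _ dst (dV _ _ (d1 _ Ss))) (dV _ _ (d1 _ St))).
  by apply: le_trans (dM _ _ _ _ dw dw) _; rewrite ler_wpM2r//; lra.
have [p ap] := hyperbolic_fixed_point tra.
have X0 := traceless_hyperbolic_neq0 tra.
have [b Sb mb] := S_lines X0 (tr_traceless _).
have [g [dg mg gp]] : exists g, [/\ displacement f g <= 2 * d,
    moves_line v (traceless (rot a)) g & action v g p <> p].
  have d12 x : S x -> displacement f x <= 2 * d.
    by move=> Sx; apply: le_trans (d1 _ Sx) _; rewrite ler_wpM2r//; lra.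
  have [bp|bp] := pselect (action v b p = p); last by exists b; split=> //; exact: d12.
  have [s Ss sp] := S_points p.
  have [ns|ms] := pselect (normalizes_line (traceless (rot a)) (rot s)); last first.
    by exists s; split=> //; exact: d12.
  exists (b * s)%g; split.
  - by apply: le_trans (dM _ _ _ _ (d1 _ Sb) (d1 _ Ss)) _; rewrite ler_wpM2r//; lra.
  - move=> nbs; apply: mb; rewrite /moves_line -(mulgK s b) linear_partM// linear_partV//.
    apply: normalizes_lineM => //; apply: normalizes_line_adj => //.
    exact: det_linear_part.
  - by rewrite actionM// -[in RHS]bp => /(congr1 (action v b^-1%g)); rewrite !actionK.
exists a, g, p; split=> //.
- apply: le_trans d_small; rewrite !ler_pM2l//; apply: le_trans da _.
  by rewrite ler_wpM2r// ler_nat.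
- apply: le_trans d_small; rewrite !ler_pM2l//.
  apply: le_trans (dM _ _ _ _ (dM _ _ _ _ dg da) (dV _ _ dg)) _.
  by rewrite -!natrD.
Qed.

(** If [H] normalized a line of sl2 or fixed a point of the plane, one of the two
coverings would prevent [f] from being almost invariant. *)
Lemma almost_invariant_dense :
  forall x, zariski_closure (SA_real R @` (v @` carrier H)) x.
Proof.
have [a [g [p [da dc tra mv [ap gp]]]]] := short_hyperbolic_pair.
apply: zariski_dense => //.
- move=> X X0 trX; apply: contrapT => no.
  apply: (@invariant_line_gap R gT v vM H f a g f1 da dc tra mv X X0 trX) => h Hh.
  by apply: contrapT => mh; apply: no; exists h.
- move=> q; apply: contrapT => no.
  apply: (@fixed_point_gap R gT v vM H f a g f1 da dc tra mv q p) => // h Hh.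
  by apply: contrapT => mh; apply: no; exists h.
Qed.
End GeneratingSets.

Theorem corollary1p4 (R : realType) :
  exists eps : R, 0 < eps /\
    forall G : subgroup (SA int),
      ~ virtually_solvable (elt G) ->
      ~ has_global_fixed_point R G ->
      forall H : subgroup (elt G),
        zariski_closure (SA_real R @` (val @` H)) `<`
          zariski_closure (SA_real R @` G) ->
        (eps%:E < kappa (lambda R H))%E.
Proof.
pose d : R := (10 * (9 * (9 * 12)))^-1.
have d0 : 0 < d by rewrite invr_gt0; lra.
have d_small : 9 * (9 * (12 * d)) <= 10^-1 by rewrite /d; lra.
exists (d / 2); split; first by rewrite divr_gt0.
move=> G nvs nfix H [_ not_dense].
suff : (d%:E <= kappa (lambda R H))%E.
  by apply: lt_le_trans; rewrite lte_fin; lra.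
apply: le_ereal_inf_tmp => _ [S /= gS <-]; apply: le_ereal_inf_tmp => _ [f /= f1 <-].
rewrite lee_fin leNgt; apply/negP => lt_d; apply: not_dense => x _.
have vM (g h : elt G) : val (g * h)%g = (val g * val h)%g by [].
apply: (almost_invariant_dense (v := val) vM (f := f) (S := [set` S]) f1 _ d_small) => //.
- move=> s /= Ss; apply: ltW; apply: le_lt_trans lt_d.
  exact: (unstable.le_bigmax_seq _ s xpredT).
- exact: (generators_move_lines vM gS val_inj nvs).
- apply: (generators_move_points vM gS) => -[p pfix]; apply: nfix; exists p => g Gg.
  have Gg' : g \in carrier G by rewrite inE.
  exact: (pfix (exist _ g Gg')).
Qed.
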